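(* Let $(\mathcal{M},\tau)$ be a tracial $W^*$-probability space and let $\{U_n\}_{n\ge1}$ be a sequence of freely independent, identically distributed (bounded, positive) random variables in $(\mathcal{M},\tau)$, with $U_1$ distributed as the uniform distribution $U(0,1)$ on $(0,1)$. Put $\tilde U_n=U_1\vee\cdots\vee U_n$ (maximum in the spectral order). Let $F$ be a distribution function on $\mathbb{R}$. Then $$\tau\bigl(E_{\tilde U_n}([0,F^{1/n}])\bigr)\xrightarrow{w}\Lambda^\vee(F),\qquad n\to\infty.$$ In particular, for every $\alpha>0$, as $n\to\infty$, $$\tau\bigl(E_{\tilde U_n}([0,C_{\mathrm{I}}^{1/n}])\bigr)\xrightarrow{w}F_{\mathrm{I}},\qquad \tau\bigl(E_{\tilde U_n}([0,C_{\mathrm{II},\alpha}^{1/n}])\bigr)\xrightarrow{w}F_{\mathrm{II},\alpha},\qquad \tau\bigl(E_{\tilde U_n}([0,C_{\mathrm{III},\alpha}^{1/n}])\bigr)\xrightarrow{w}F_{\mathrm{III},\alpha}.$$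
   Context: A tracial $W^*$-probability space is a von Neumann algebra $\mathcal{M}$ with a normal faithful tracial state $\tau$. For a selfadjoint $X\in\mathcal{M}$, $E_X$ is its spectral measure, and its distribution $\mu$ satisfies $\mu(B)=\tau(E_X(B))$. For selfadjoint $X,Y\in\mathcal{M}$, the maximum $X\vee Y$ in the spectral order is the selfadjoint element determined by $E_{X\vee Y}((x,\infty))=E_X((x,\infty))\vee E_Y((x,\infty))$ for all $x\in\mathbb{R}$, where $P\vee Q$ for projections is the projection onto the closure of $P\mathcal{H}+Q\mathcal{H}$. For a distribution function $F$, the expression $\tau(E_{\tilde U_n}([0,F^{1/n}]))$ denotes the function $x\mapsto\tau(E_{\tilde U_n}([0,F(x)^{1/n}]))$ on $\mathbb{R}$. The notation $H_n\xrightarrow{w}H$ means $H_n(x)\to H(x)$ at every continuity point $x$ of $H$. $\Lambda^\vee:[0,1]\to[0,1]$ is defined by $\Lambda^\vee(0)=0$ and $\Lambda^\vee(x)=\max\{0,1+\log x\}$ for $x\in(0,1]$; $\Lambda^\vee(F)$ is the distribution function $x\mapsto\Lambda^\vee(F(x))$. Classical extreme value distributions: $C_{\mathrm{I}}(x)=\exp(-\exp(-x))$, $x\in\mathbb{R}$; $C_{\mathrm{II},\alpha}(x)=\exp(-x^{-\alpha})$ for $x>0$ and $0$ for $x\le 0$; $C_{\mathrm{III},\alpha}(x)=\exp(-(-x)^\alpha)$ for $x\le 0$ and $1$ for $x>0$. Free extreme value distributions: $F_{\mathrm{I}}(x)=\max\{0,1-e^{-x}\}$, $x\in\mathbb{R}$;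 $F_{\mathrm{II},\alpha}(x)=\max\{0,1-x^{-\alpha}\}$ for $x>0$ and $0$ for $x\le0$; $F_{\mathrm{III},\alpha}(x)=1-|x|^\alpha$ for $-1\le x\le 0$, $0$ for $x<-1$, $1$ for $x>0$. *)

(* Defs.v *)
From mathcomp Require Import all_boot all_order all_algebra sesquilinear.
From mathcomp Require Import complex.
From mathcomp Require Import all_classical all_reals all_analysis.

Set Implicit Arguments.
Unset Strict Implicit.
Unset Printing Implicit Defensive.

Import Order.TTheory GRing.Theory Num.Theory.
Import numFieldNormedType.Exports.
Local Open Scope classical_set_scope.
Local Open Scope ring_scope.
Local Open Scope complex_scope.

(* A complex Hilbert space is a complete normed space [H] over [R[i]] together
   with a positive definite hermitian form [ip] (linear in its first argument)
   inducing the norm of [H]. Operators on [H] are plain functions [H -> H]. *)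
Definition hilbert_norm (R : realType) (H : completeNormedModType R[i])
    (ip : {dot H for Num.conj}) : Prop :=
  forall x : H, `|x| ^+ 2 = ip x x.

Section Operators.
Context (R : realType) (H : completeNormedModType R[i]).
Variable ip : {dot H for Num.conj}.
Implicit Types (A B P Q S T X Y Z : H -> H) (M : set (H -> H)).

Definition bounded_operators : set (H -> H) :=
  [set T | linear T /\ continuous T].

Definition adjoint_of T S : Prop := forall x y, ip (T x) y = ip x (S y).

Definition selfadjoint T : Prop := adjoint_of T T.

Definition positive_op T : Prop := forall x, 0 <= ip (T x) x.

Definition le_op A B : Prop := positive_op (B \- A).

Definition orth_proj P : Prop :=
  [/\ bounded_operators P, P \o P = P & selfadjoint P].

Definition proj_join P Q S : Prop :=
  orth_proj S /\
  range S = closure [set p + q | p in range P & q in range Q].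

Definition commutant M : set (H -> H) :=
  [set T | bounded_operators T /\ forall A, M A -> T \o A = A \o T].

(* A von Neumann algebra is a selfadjoint subset of B(H) which equals its
   bicommutant; it is then automatically a unital subalgebra. *)
Definition von_neumann_algebra M : Prop :=
  [/\ M `<=` bounded_operators,
      (forall T S, M T -> bounded_operators S -> adjoint_of T S -> M S) &
      commutant (commutant M) = M].

Definition directed (D : set (H -> H)) : Prop :=
  forall A B, D A -> D B -> exists C, [/\ D C, le_op A C & le_op B C].

Definition lub_in M (D : set (H -> H)) A : Prop :=
  [/\ M A, (forall B, D B -> le_op B A) &
      forall C, M C -> (forall B, D B -> le_op B C) -> le_op A C].

(* Only the values of [tau] on [M] are relevant. In [R[i]], [0 <= z] means that
   [z] is real and nonnegative. *)
Definition state M (tau : (H -> H) -> R[i]) : Prop :=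
  [/\ (forall (c : R[i]) A B, M A -> M B ->
         tau (fun x => c *: A x + B x) = c * tau A + tau B),
      (forall A, M A -> positive_op A -> 0 <= tau A) &
      tau idfun = 1].

Definition tracial_state M (tau : (H -> H) -> R[i]) : Prop :=
  forall A B, M A -> M B -> tau (A \o B) = tau (B \o A).

Definition faithful_state M (tau : (H -> H) -> R[i]) : Prop :=
  forall A, M A -> positive_op A -> tau A = 0 -> A = (fun=> 0).

Definition normal_state M (tau : (H -> H) -> R[i]) : Prop :=
  forall (D : set (H -> H)) A,
    D !=set0 -> (forall B, D B -> M B /\ positive_op B) ->
    directed D -> lub_in M D A ->
    complex.Re (tau A) = sup [set complex.Re (tau B) | B in D].

Definition tracial_Wstar_probability_space M (tau : (H -> H) -> R[i]) : Prop :=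
  von_neumann_algebra M /\
  [/\ state M tau, tracial_state M tau, faithful_state M tau & normal_state M tau].

(* [E] is a projection-valued Borel measure on the real line and [X] is the
   integral of the identity function against [E]. Countable additivity of [E]
   is that of the scalar measures [B |-> <E(B) xi, xi>]. Values of [E] on
   non-Borel sets are irrelevant. *)
Definition is_spectral_measure X (E : set R -> H -> H) : Prop :=
  [/\ (forall B : set R, measurable B -> orth_proj (E B)),
      E setT = idfun,
      (forall B C : set R, measurable B -> measurable C ->
         E (B `&` C) = E B \o E C) &
      forall xi : H, exists mu : {measure set R -> \bar R},
        [/\ (forall B : set R, measurable B ->
               mu B = (complex.Re (ip (E B xi) xi))%:E),
            mu.-integrable setT (fun x => x%:E) &
            ip (X xi) xi = (\int[mu]_(x in setT) x)%:C]].

(* The spectral measure of a selfadjoint operator, given by choice; the default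
   value is only taken when there is none. *)
Definition spectral_measure X : set R -> H -> H :=
  xget (fun _ _ => 0) [set E | is_spectral_measure X E].

Definition spectral_max M X Y Z : Prop :=
  [/\ M Z, selfadjoint Z &
      forall x : R, proj_join (spectral_measure X `]x, +oo[)
        (spectral_measure Y `]x, +oo[) (spectral_measure Z `]x, +oo[)].

(* [tau (spectral_measure X B)] is real, as [tau] is positive. *)
Definition spectral_distribution (tau : (H -> H) -> R[i]) X (B : set R) : R :=
  complex.Re (tau (spectral_measure X B)).

Definition unital_subalgebra (A : set (H -> H)) : Prop :=
  [/\ A idfun,
      (forall (c : R[i]) S T, A S -> A T -> A (fun x => c *: S x + T x)) &
      forall S T, A S -> A T -> A (S \o T)].

Definition generated_algebra X : set (H -> H) :=
  smallest unital_subalgebra [set X].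

Definition free_subalgebras (I : Type) (tau : (H -> H) -> R[i])
    (A : I -> set (H -> H)) : Prop :=
  forall (k : nat) (i : nat -> I) (a : nat -> H -> H),
    (0 < k)%N ->
    (forall j, (j < k)%N -> A (i j) (a j) /\ tau (a j) = 0) ->
    (forall j, (j.+1 < k)%N -> i j <> i j.+1) ->
    tau (\big[(fun S T => S \o T)/idfun]_(j < k) a j) = 0.

Definition freely_independent (I : Type) (tau : (H -> H) -> R[i])
    (X : I -> H -> H) : Prop :=
  free_subalgebras tau (fun i => generated_algebra (X i)).

End Operators.

Section DistributionFunctions.
Context (R : realType).
Implicit Types (x alpha : R).

Definition weak_cvg (Hn : nat -> R -> R) (G : R -> R) : Prop :=
  forall x, {for x, continuous G} -> Hn n x @[n --> \oo] --> G x.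

(* Only used on [0, 1]. *)
Definition Lambda_max (u : R) : R :=
  if u <= 0 then 0 else Num.max 0 (1 + ln u).

Definition C_I x : R := expR (- expR (- x)).

Definition C_II alpha x : R := if 0 < x then expR (- x `^ (- alpha)) else 0.

Definition C_III alpha x : R :=
  if x <= 0 then expR (- (- x) `^ alpha) else 1.

Definition F_I x : R := Num.max 0 (1 - expR (- x)).

Definition F_II alpha x : R :=
  if 0 < x then Num.max 0 (1 - x `^ (- alpha)) else 0.

Definition F_III alpha x : R :=
  if x < -1 then 0 else if x <= 0 then 1 - `|x| `^ alpha else 1.

End DistributionFunctions.

(* Main.v *)
From HB Require Import structures.
Require Import Defs.
From mathcomp Require Import all_boot all_order all_algebra sesquilinear.
From mathcomp Require Import complex.
From mathcomp Require Import all_classical all_reals all_analysis.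
From mathcomp Require Import ring lra.

Set Implicit Arguments.
Unset Strict Implicit.
Unset Printing Implicit Defensive.

Import Order.TTheory GRing.Theory Num.Theory.
Import numFieldNormedType.Exports.
Local Open Scope classical_set_scope.
Local Open Scope ring_scope.
Local Open Scope complex_scope.

(** The theorem reduces to an exact formula: for [0 <= t <= 1], the trace of
    [E_(Ut n) [0, t]] is [max 0 (1 - (n + 1) (1 - t))] ([distribution_max]). With
    [t := F x ^ (1 / (n + 1))] the quantity [(n + 1) (1 - t)] tends to
    [- ln (F x)] when [F x > 0], so that the formula tends to [Lambda_max (F x)];
    when [F x = 0], both are [0] ([root_limit]); the extreme value laws are the images under [Lambda_max] of
    the classical ones.

    By definition of the spectral order, [E_(Ut n) [0, t]] is the infimum [e] of the
    projections [P i := E_(U i) ]-oo, t]], [i <= n], each of trace [t]. Write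
    [q := 1 - t].

    The trace of [e] is at least [1 - (n + 1) q] because [1 - e] is the join of the
    [1 - P i] and a normal tracial state is subadditive on projections
    ([rtau_join_le]). With [Q^c := 1 - Q], the projections satisfy an intertwining
    relation between [Q^c P^c Q^c] and [P Q P], by which the powers of these two
    positive contractions lose the same amount of trace; the powers of the first
    decrease to the projection on the complement of the join, and normality passes
    to the limit.

    The trace of [e] is at most [max 0 (1 - (n + 1) q)] because the [P i] are free.
    For the scalar product defined by the trace, freeness says that the alternating
    words in the centered projections [p i := P i - t] are orthogonal, a word of
    length [k] having squared norm [(t q)^k] ([word_orthogonal]). As [e P i = e],
    the scalar product of such a word with [e] is [q^k] times the trace of [e].
    There are [(n + 1) n^(k - 1)] words of length [k >= 1], and Bessel's inequality
    bounds the inverse of the trace of [e] from below by the resulting geometric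
    series ([bessel_words], [rtau_inf_le]).

    Freeness is given for the algebras of polynomials in the [U i], and must be
    transferred to the [P i]. The polynomials [bump] tend to the indicator function
    of a half-line, so that they approach [P i] in the 2-norm up to the trace of a
    small spectral interval ([spectral_cutoff], [spec_le_l2_approx]), and the trace
    of a product is continuous for the 2-norm in each factor ([centered_limit],
    [free_centered]). The same polynomials show that the spectral projections
    commute with everything that commutes with the operator, hence belong to the
    von Neumann algebra ([vn_spec]). *)

(** * Real inner product and bounded operators *)

Section ComplexParts.
Context (R : realType).
Implicit Types z w : R[i].

Lemma ReD z w : complex.Re (z + w) = complex.Re z + complex.Re w.
Proof. by case: z w => a b [c d]. Qed.

Lemma ReN z : complex.Re (- z) = - complex.Re z.
Proof. by case: z. Qed.

Lemma ReB z w : complex.Re (z - w) = complex.Re z - complex.Re w.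
Proof. by rewrite ReD ReN. Qed.

Lemma ReZ (a : R) z : complex.Re (a%:C * z) = a * complex.Re z.
Proof. by case: z => b c /=; rewrite mul0r subr0. Qed.

Lemma ReJ z : complex.Re (Num.conj z) = complex.Re z.
Proof. by case: z. Qed.

Lemma conj_realC (a : R) : Num.conj (a%:C) = a%:C :> R[i].
Proof. exact: conjc_real. Qed.

Lemma ge0_ReK z : 0 <= z -> z = (complex.Re z)%:C.
Proof. by case: z => a b; rewrite lecE /= => /andP[/eqP -> _]. Qed.

Lemma ge0_Re z : 0 <= z -> 0 <= complex.Re z.
Proof. by case: z => a b; rewrite lecE /= => /andP[_]. Qed.

End ComplexParts.

Section Hilbert.
Context (R : realType) (H : completeNormedModType R[i]).
Context (ip : {dot H for Num.conj}).
Implicit Types (x y z : H) (A B P Q S T X : H -> H).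

Definition rip x y : R := complex.Re (ip x y).

(** The squared norm. Estimates are carried out on it rather than on the norm,
    which takes its values in the complex numbers. *)
Definition nsq x : R := rip x x.

Lemma ipC x y : ip x y = Num.conj (ip y x).
Proof. by rewrite hermC mul1r. Qed.

Lemma ipDl x y z : ip (x + y) z = ip x z + ip y z.
Proof. exact: linearDl. Qed.

Lemma ipDr x y z : ip z (x + y) = ip z x + ip z y.
Proof. exact: linearDr. Qed.

Lemma ipNl x y : ip (- x) y = - ip x y.
Proof. exact: linearNl. Qed.

Lemma ipNr x y : ip x (- y) = - ip x y.
Proof. exact: linearNr. Qed.

Lemma ipBl x y z : ip (x - y) z = ip x z - ip y z.
Proof. by rewrite ipDl ipNl. Qed.

Lemma ipBr x y z : ip z (x - y) = ip z x - ip z y.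
Proof. by rewrite ipDr ipNr. Qed.

Lemma ipZl c x y : ip (c *: x) y = c * ip x y.
Proof. exact: linearZl_LR. Qed.

Lemma ipZr c x y : ip x (c *: y) = Num.conj c * ip x y.
Proof. exact: linearZr_LR. Qed.

Lemma ip0l y : ip 0 y = 0. Proof. exact: linear0l. Qed.

Lemma ip0r y : ip y 0 = 0. Proof. exact: linear0r. Qed.

Lemma ripC x y : rip x y = rip y x.
Proof. by rewrite /rip ipC ReJ. Qed.

Lemma ripDl x y z : rip (x + y) z = rip x z + rip y z.
Proof. by rewrite /rip ipDl ReD. Qed.

Lemma ripDr x y z : rip z (x + y) = rip z x + rip z y.
Proof. by rewrite /rip ipDr ReD. Qed.

Lemma ripNl x y : rip (- x) y = - rip x y.
Proof. by rewrite /rip ipNl ReN. Qed.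

Lemma ripNr x y : rip x (- y) = - rip x y.
Proof. by rewrite /rip ipNr ReN. Qed.

Lemma ripZl (a : R) x y : rip (a%:C *: x) y = a * rip x y.
Proof. by rewrite /rip ipZl ReZ. Qed.

Lemma ripZr (a : R) x y : rip x (a%:C *: y) = a * rip x y.
Proof. by rewrite ripC ripZl ripC. Qed.

Lemma rip0l y : rip 0 y = 0. Proof. by rewrite /rip ip0l. Qed.

Definition ripE := (ripDl, ripDr, ripNl, ripNr, ripZl, ripZr).

Lemma nsq_ge0 x : 0 <= nsq x.
Proof. exact/ge0_Re/dnorm_ge0. Qed.

Lemma ipxx x : ip x x = (nsq x)%:C.
Proof. by rewrite /nsq /rip -ge0_ReK// dnorm_ge0. Qed.

Lemma nsq_eq0 x : nsq x = 0 -> x = 0.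
Proof.
by move=> x0; apply/eqP; rewrite -(dnorm_eq0 ip) ipxx x0.
Qed.

Lemma nsq_le0 x : nsq x <= 0 -> x = 0.
Proof. by move=> x0; apply/nsq_eq0/eqP; rewrite eq_le x0 nsq_ge0. Qed.

Lemma nsq0 : nsq 0 = 0. Proof. exact: rip0l. Qed.

Lemma nsqD x y : nsq (x + y) = nsq x + nsq y + 2 * rip x y.
Proof. rewrite /nsq !ripE (ripC y x); ring. Qed.

Lemma nsqN x : nsq (- x) = nsq x.
Proof. by rewrite /nsq !ripE opprK. Qed.

Lemma nsqB x y : nsq (x - y) = nsq x + nsq y - 2 * rip x y.
Proof. rewrite nsqD nsqN ripNr; ring. Qed.

Lemma nsqZ (a : R) x : nsq (a%:C *: x) = a ^+ 2 * nsq x.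
Proof. rewrite /nsq !ripE; ring. Qed.

Lemma nsqD_le x y : nsq (x + y) <= 2 * (nsq x + nsq y).
Proof. have := nsq_ge0 (x - y); rewrite nsqB nsqD; lra. Qed.

(** ** Linear operators *)

Lemma linD A : linear A -> {morph A : x y / x + y}.
Proof. by move=> lA x y; have := lA 1 x y; rewrite !scale1r. Qed.

Lemma lin0 A : linear A -> A 0 = 0.
Proof.
move=> lA; have /esym/eqP := linD lA 0 0.
by rewrite addr0 -subr_eq0 addrK => /eqP.
Qed.

Lemma linZ A c x : linear A -> A (c *: x) = c *: A x.
Proof. by move=> lA; have := lA c x 0; rewrite !addr0 lin0// addr0. Qed.

Lemma linN A x : linear A -> A (- x) = - A x.
Proof. by move=> lA; rewrite -scaleN1r linZ// scaleN1r. Qed.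

Lemma linB A : linear A -> {morph A : x y / x - y}.
Proof. by move=> lA x y; rewrite linD// linN. Qed.

Lemma linear_comp_op A B : linear A -> linear B -> linear (A \o B).
Proof. by move=> lA lB c x y /=; rewrite lB lA. Qed.

Lemma linear_comb_op c A B : linear A -> linear B ->
  linear (fun x => c *: A x + B x).
Proof.
by move=> lA lB d x y; rewrite lA lB !scalerDr !scalerA mulrC addrACA.
Qed.

Lemma linear_iter A k : linear A -> linear (iter k A).
Proof. by move=> lA; elim: k => [//|k IH] c x y; rewrite !iterS IH lA. Qed.

Lemma iter_commute A B k : (forall x, A (B x) = B (A x)) ->
  forall x, iter k A (B x) = B (iter k A x).
Proof. by move=> AB x; elim: k => //= k ->. Qed.

(** ** Adjoints and forms *)

Lemma adjointC A B : adjoint_of ip A B -> adjoint_of ip B A.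
Proof. by move=> AB x y; rewrite ipC -AB -ipC. Qed.

Lemma adjoint_comp A A' B B' : adjoint_of ip A A' -> adjoint_of ip B B' ->
  adjoint_of ip (A \o B) (B' \o A').
Proof. by move=> hA hB x y; rewrite /= hA hB. Qed.

Lemma adjoint_comb c A A' B B' : adjoint_of ip A A' -> adjoint_of ip B B' ->
  adjoint_of ip (fun x => c *: A x + B x)
                (fun x => Num.conj c *: A' x + B' x).
Proof.
by move=> hA hB x y; rewrite ipDl ipDr ipZl ipZr conjCK hA hB.
Qed.

Lemma adjoint_rip A B x y : adjoint_of ip A B -> rip (A x) y = rip x (B y).
Proof. by move=> AB; rewrite /rip AB. Qed.

Lemma selfadjoint_iter A k : selfadjoint ip A -> selfadjoint ip (iter k A).
Proof. by move=> sA; elim: k => // k IH x y; rewrite iterSr /= IH sA. Qed.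

Lemma selfadjoint_ip_real A x : selfadjoint ip A ->
  ip (A x) x = (rip (A x) x)%:C.
Proof.
move=> sA; have : Num.conj (ip (A x) x) = ip (A x) x by rewrite -ipC sA.
rewrite /rip; case: (ip (A x) x) => a b [] /= /eqP.
by rewrite -subr_eq0 -opprD oppr_eq0 -mulr2n mulrn_eq0 /= => /eqP ->.
Qed.

Lemma positive_op_rip A : selfadjoint ip A ->
  (forall x, 0 <= rip (A x) x) -> positive_op ip A.
Proof. by move=> sA pA x; rewrite selfadjoint_ip_real// ler0c. Qed.

(** For [0 <= A <= c], expand the form of [A] at [x - l A x] with [l := 1 / c]. *)
Lemma form_le_nsq A (c : R) : linear A -> selfadjoint ip A -> 0 < c ->
  (forall x, 0 <= rip (A x) x <= c * nsq x) ->
  forall x, nsq (A x) <= c * rip (A x) x.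
Proof.
move=> lA sA c0 hA x.
have key (l : R) : 0 <= rip (A x) x - 2 * l * nsq (A x) + l ^+ 2 * (c * nsq (A x)).
  have /andP[+ _] := hA (x - l%:C *: A x); have /andP[_ +] := hA (A x).
  rewrite linB// linZ// !ripE (adjoint_rip (A x) x sA) -/(nsq (A x)).
  nra.
have c_neq0 : c != 0 by rewrite gt_eqF.
have := key c^-1; rewrite mulrA (_ : c^-1 ^+ 2 * c = c^-1); last by field.
rewrite -(ler_pM2l c0) mulr0 mulrDr mulrBr.
rewrite (_ : c * (2 * c^-1 * _) = 2 * nsq (A x)); last by field.
rewrite (_ : c * (c^-1 * _) = nsq (A x)); last by field.
by move=> ?; lra.
Qed.

Lemma form_le_norm A (c : R) : linear A -> selfadjoint ip A -> 0 < c ->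
  (forall x, 0 <= rip (A x) x <= c * nsq x) ->
  forall x, nsq (A x) <= c ^+ 2 * nsq x.
Proof.
move=> lA sA c0 hA x; apply: (le_trans (form_le_nsq lA sA c0 hA x)).
rewrite expr2 -mulrA; apply: ler_wpM2l; first exact: ltW.
by have /andP[] := hA x.
Qed.

(** Expand the squared norm of [A x - b x]. *)
Lemma form_ge_norm A (b : R) x : 0 <= b -> b * nsq x <= rip (A x) x ->
  b ^+ 2 * nsq x <= nsq (A x).
Proof.
move=> b0 hA; have := nsq_ge0 (A x - b%:C *: x).
rewrite nsqB nsqZ ripZr => h; have := ler_wpM2l b0 hA; lra.
Qed.

(** ** Orthogonal projections *)

Section Projection.
Context P (hP : orth_proj ip P).

Lemma proj_bounded : bounded_operators P. Proof. by case: hP. Qed.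

Lemma proj_linear : linear P. Proof. by case: hP => [[]]. Qed.

Lemma proj_idem x : P (P x) = P x.
Proof. by case: hP => _ PP _; rewrite -[RHS](f_equal (@^~ x) PP). Qed.

Lemma proj_sa : selfadjoint ip P. Proof. by case: hP. Qed.

Lemma rip_proj x : rip (P x) x = nsq (P x).
Proof. by rewrite -{1}proj_idem (adjoint_rip _ _ proj_sa). Qed.

Lemma rip_proj_l x y : rip (P x) y = rip (P x) (P y).
Proof. by rewrite -{1}proj_idem (adjoint_rip _ _ proj_sa). Qed.

Lemma nsq_proj_split x : nsq x = nsq (P x) + nsq (x - P x).
Proof. rewrite nsqB (ripC x) rip_proj; ring. Qed.

Lemma nsq_proj_le x : nsq (P x) <= nsq x.
Proof. by rewrite (nsq_proj_split x) lerDl nsq_ge0. Qed.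

Lemma proj_positive : positive_op ip P.
Proof.
by apply: positive_op_rip; [exact: proj_sa|move=> x; rewrite rip_proj nsq_ge0].
Qed.

Lemma range_projE x : range P x <-> P x = x.
Proof. by split=> [[y _ <-]|<-]; [exact: proj_idem|exists x]. Qed.

End Projection.

(** ** Topology, in terms of the squared norm *)

Section Topology.
Hypothesis hH : hilbert_norm ip.

Lemma norm_ltP x (e : R) : 0 < e -> (`|x| < e%:C) = (nsq x < e ^+ 2).
Proof.
move=> e0; have e0' : 0 <= e%:C :> R[i] by rewrite lecR ltW.
by rewrite -(@ltr_pXn2r _ 2)// ?nnegrE// hH ipxx -rmorphXn ltcR.
Qed.

Lemma closureP_nsq (D : set H) x :
  closure D x <-> forall e : R, 0 < e -> exists2 y, D y & nsq (x - y) < e.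
Proof.
split=> [Dx e e0|Dx B /nbhs_ballP[r /= r0 rB]].
  have s0 : 0 < Num.sqrt e by rewrite sqrtr_gt0.
  have s0' : 0 < (Num.sqrt e)%:C :> R[i] by rewrite ltcR.
  have [y [Dy]] := Dx _ (nbhsx_ballx x _ s0').
  rewrite -ball_normE /= norm_ltP// sqr_sqrtr ?ltW// => xy.
  by exists y.
have rE := ge0_ReK (ltW r0).
have rR : 0 < complex.Re r by move: r0; rewrite rE ltcR.
have [|y Dy xy] := Dx (complex.Re r ^+ 2); first by rewrite exprn_gt0.
exists y; split=> //; apply: rB; rewrite -ball_normE /= rE norm_ltP//.
Qed.

Lemma bounded_nsq T : bounded_operators T ->
  exists2 C : R, 0 < C & forall x, nsq (T x) <= C * nsq x.
Proof.
move=> [lT cT].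
pose isL := GRing.isLinear.Build _ _ _ _ T lT.
pose f : {linear H -> H} := HB.pack T isL.
have /linear_boundedP : bounded_near f (nbhs (0 : H)).
  by apply: continuous_linear_bounded; exact: cT.
move=> [M [Mr hM]]; pose r : R := `|complex.Re M| + 1.
have r0 : 0 < r by rewrite ltr_wpDl.
have Mlt : M < r%:C.
  move: Mr; case: (M) @r r0 => a b /= r0; rewrite complex_real => /eqP ->.
  by rewrite ltcR ltr_pwDr// ler_norm.
exists (r ^+ 2) => [|x]; first by rewrite exprn_gt0.
have := hM _ Mlt x; rewrite /= -(@ler_pXn2r _ 2)// ?nnegrE//; last first.
  by rewrite mulr_ge0// lecR ltW.
by rewrite exprMn !hH !ipxx -rmorphXn -rmorphM lecR.
Qed.

End Topology.

Lemma bounded_comp A B : bounded_operators A -> bounded_operators B ->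
  bounded_operators (A \o B).
Proof.
move=> [lA cA] [lB cB]; split; first exact: linear_comp_op.
by move=> x; apply: continuous_comp; [exact: cB|exact: cA].
Qed.

Lemma bounded_comb c A B : bounded_operators A -> bounded_operators B ->
  bounded_operators (fun x => c *: A x + B x).
Proof.
move=> [lA cA] [lB cB]; split; first exact: linear_comb_op.
by move=> x; apply: cvgD; [apply: cvgZl_tmp; exact: cA|exact: cB].
Qed.

Lemma bounded_id : bounded_operators (@idfun H).
Proof. by split=> // x; exact: cvg_id. Qed.

End Hilbert.
(** * Spectral measures *)

Section IntegralSplit.
Context (R : realType) (mu : {measure set R -> \bar R}) (B : set R).
Hypothesis mB : measurable B.

Lemma integral_compl_split : (\int[mu]_(x in setT) x%:E =
  \int[mu]_(x in B) x%:E + \int[mu]_(x in ~` B) x%:E)%E.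
Proof.
have mC := measurableC mB.
rewrite -[in LHS](setUv B) integral_setU//; last by rewrite disj_set2E setICr.
Qed.

Lemma integral_null_compl : mu (~` B) = 0%E ->
  (\int[mu]_(x in setT) x%:E = \int[mu]_(x in B) x%:E)%E.
Proof.
move=> mu0; have mC := measurableC mB.
by rewrite integral_compl_split [X in (_ + X)%E](null_set_integral _ _ mu0) ?adde0.
Qed.

End IntegralSplit.

Section SpectralMeasure.
Context (R : realType) (H : completeNormedModType R[i]).
Context (ip : {dot H for Num.conj}).
Context (X : H -> H) (E : set R -> H -> H).
Hypothesis hE : is_spectral_measure ip X E.
Implicit Types (B C : set R) (xi : H) (a b t : R).

Local Notation rip := (rip ip).
Local Notation nsq := (nsq ip).

Lemma spec_proj B : measurable B -> orth_proj ip (E B).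
Proof. by case: hE => + _ _ _; apply. Qed.

Lemma spec_lin B : measurable B -> linear (E B).
Proof. by move=> mB; exact: proj_linear (spec_proj mB). Qed.

Lemma specT xi : E setT xi = xi.
Proof. by case: hE => _ -> _ _. Qed.

Lemma specI B C xi : measurable B -> measurable C ->
  E B (E C xi) = E (B `&` C) xi.
Proof. by move=> mB mC; case: hE => _ _ -> // _. Qed.

(** The positive measure [B |-> <E B xi, xi>], whose mean is [<X xi, xi>]. *)
Lemma spec_measure xi : exists mu : {measure set R -> \bar R},
  [/\ forall B, measurable B -> mu B = (nsq (E B xi))%:E,
      mu.-integrable setT (fun x => x%:E) &
      (\int[mu]_(x in setT) x%:E)%E = (rip (X xi) xi)%:E].
Proof.
case: hE => hP _ _ /(_ xi)[mu [muE imu Xmu]]; exists mu; split=> //.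
  by move=> B mB; rewrite muE// -(rip_proj (hP _ mB)).
rewrite /rip Xmu /= /Rintegral fineK//.
exact: integrable_fin_num.
Qed.

Lemma spec0 xi : E set0 xi = 0.
Proof.
have [mu [muE _ _]] := spec_measure xi.
apply: (nsq_eq0 (ip := ip)).
by have := muE _ measurable0; rewrite measure0 => -[<-].
Qed.

Lemma spec_disjoint B C xi : measurable B -> measurable C -> B `&` C = set0 ->
  E B (E C xi) = 0.
Proof. by move=> mB mC BC; rewrite specI// BC spec0. Qed.

Lemma spec_sub B C xi : measurable B -> measurable C -> B `<=` C ->
  E C (E B xi) = E B xi.
Proof. by move=> mB mC BC; rewrite specI// setIC setIidl. Qed.

Lemma spec_nsqU B C xi : measurable B -> measurable C -> B `&` C = set0 ->
  nsq (E (B `|` C) xi) = nsq (E B xi) + nsq (E C xi).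
Proof.
move=> mB mC BC; have [mu [muE _ _]] := spec_measure xi.
have : mu (B `|` C) = (mu B + mu C)%E by exact: measureU.
rewrite !muE//; last exact: measurableU.
by rewrite -EFinD => -[].
Qed.

Lemma specC B xi : measurable B -> E (~` B) xi = xi - E B xi.
Proof.
move=> mB; have mC := measurableC mB.
apply/eqP; rewrite eq_sym -subr_eq0; apply/eqP/(nsq_eq0 (ip := ip)).
have := spec_nsqU xi mB mC (setICr B); rewrite setUv specT.
rewrite (nsq_proj_split (spec_proj mB)) => /addrI h.
rewrite nsqB h.
have -> : rip (xi - E B xi) (E (~` B) xi) = nsq (E (~` B) xi).
  rewrite ripC (rip_proj_l (spec_proj mC)) (linB (spec_lin mC)).
  by rewrite [X in _ - X]spec_disjoint ?subr0// setIC setICr.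
ring.
Qed.

Lemma spec_countable_null (F : nat -> set R) xi :
  (forall n, measurable (F n)) -> (forall n, E (F n) xi = 0) ->
  E (\bigcup_n F n) xi = 0.
Proof.
move=> mF F0; have [mu [muE _ _]] := spec_measure xi.
have mU : measurable (\bigcup_n F n) by exact: bigcupT_measurable.
apply: (@nsq_le0 _ _ ip); rewrite -lee_fin -muE//.
apply: (le_trans (@measure_sigma_subadditive _ _ _ mu _ F mF mU (@subset_refl _ _))).
by rewrite eseries0// => n _ _; rewrite muE// F0 nsq0.
Qed.

Lemma spec_right_cont a xi (e : R) : 0 < e ->
  exists2 b, a < b & nsq (E `]a, b] xi) < e.
Proof.
move=> e0; have [mu [muE _ _]] := spec_measure xi.
pose F n : set R := `]a, a + n.+1%:R^-1]%classic.
have mF n : measurable (F n) by exact: measurable_itv.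
have F0 : \bigcap_n F n = set0.
  apply/eqP/negPn/negP => /set0P[x Fx].
  have ax : a < x by have := Fx 0%N I; rewrite /F /= in_itv /= => /andP[].
  have xa0 : 0 < x - a by rewrite subr_gt0.
  have [n _ /(_ n (leqnn n))] := near_infty_natSinv_lt (PosNum xa0).
  rewrite /= ltrBrDl => hn.
  by have := Fx n I; rewrite /F /= in_itv /= => /andP[_]; rewrite leNgt hn.
have /= := @nonincreasing_cvg_mu _ _ _ mu F _ mF _ _.
rewrite F0 measure0 => cv.
have {}cv : mu \o F @ \oo --> 0%E.
  apply: cv => //.
    by rewrite muE// ltry.
  move=> m n mn; apply/subsetPset => x; rewrite /F /= !in_itv /= => /andP[-> xn] /=.
  by rewrite (le_trans xn)// lerD2l lef_pV2 ?posrE// ler_nat.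
have rE : mu \o F = (fun n => (nsq (E (F n) xi))%:E).
  by apply/funext => n /=; rewrite muE.
rewrite rE in cv; have /fine_cvgP[_ /=] := cv => cvr.
have [n _ /(_ n (leqnn n)) /= h] := cvgr_lt _ cvr _ e0.
by exists (a + n.+1%:R^-1) => //; rewrite ltrDl.
Qed.

(** The measure of a vector in the range of [E B] is carried by [B]. *)
Lemma spec_form_le B a xi : measurable B -> (forall x, B x -> x <= a) ->
  E B xi = xi -> rip (X xi) xi <= a * nsq xi.
Proof.
move=> mB Ba Exi; have [mu [muE imu Xmu]] := spec_measure xi.
have mC := measurableC mB.
have mu0 : mu (~` B) = 0 by rewrite muE// specC// Exi subrr nsq0.
rewrite -lee_fin -Xmu (integral_null_compl mB mu0) EFinM -[in nsq _]Exi -muE// -integral_cst//.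
apply: le_integral => //.
- exact: integrableS imu.
- apply/integrableP; split=> //; rewrite integral_cst// -?EFin_normr.
  by rewrite muE// -EFinM ltry.
- by move=> x /set_mem Bx; rewrite lee_fin Ba.
Qed.

Lemma spec_form_ge B a xi : measurable B -> (forall x, B x -> a <= x) ->
  E B xi = xi -> a * nsq xi <= rip (X xi) xi.
Proof.
move=> mB Ba Exi; have [mu [muE imu Xmu]] := spec_measure xi.
have mC := measurableC mB.
have mu0 : mu (~` B) = 0 by rewrite muE// specC// Exi subrr nsq0.
rewrite -lee_fin -Xmu (integral_null_compl mB mu0) EFinM -[in nsq _]Exi -muE// -integral_cst//.
apply: le_integral => //.
- apply/integrableP; split=> //; rewrite integral_cst// -?EFin_normr.
  by rewrite muE// -EFinM ltry.
- exact: integrableS imu.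
- by move=> x /set_mem Bx; rewrite lee_fin Ba.
Qed.

(** The measure of [E B xi] is the restriction to [B] of the measure of [xi]. *)
Lemma spec_restrict B xi : measurable B ->
  exists mu : {measure set R -> \bar R},
    (\int[mu]_(x in B) x%:E)%E = (rip (X (E B xi)) (E B xi))%:E /\
    forall C, measurable C -> C `<=` B -> mu C = (nsq (E C xi))%:E.
Proof.
move=> mB; have [mu [muE imu Xmu]] := spec_measure (E B xi).
have mC := measurableC mB.
exists mu; split=> [|C mC' CB]; last by rewrite muE// specI// setIidl.
have mu0 : mu (~` B) = 0 by rewrite muE// spec_disjoint ?nsq0// setIC setICr.
by rewrite -Xmu (integral_null_compl mB mu0).
Qed.

Lemma spec_form_split B xi : measurable B ->
  rip (X xi) xi = rip (X (E B xi)) (E B xi)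
                  + rip (X (E (~` B) xi)) (E (~` B) xi).
Proof.
move=> mB; have mC := measurableC mB.
have [mu [muE imu Xmu]] := spec_measure xi.
have [mu1 [Xmu1 mu1E]] := spec_restrict xi mB.
have [mu2 [Xmu2 mu2E]] := spec_restrict xi mC.
apply: EFin_inj; rewrite EFinD -Xmu -Xmu1 -Xmu2.
rewrite (integral_compl_split _ mB).
by congr (_ + _)%E; apply: eq_measure_integral => C mC' CB;
  rewrite muE// ?mu1E ?mu2E.
Qed.

Hypotheses (lX : linear X) (sX : selfadjoint ip X).

(** The form of [X] has no cross terms between the ranges of [E B] and
    [E (~` B)]; polarizing, neither has [X]. *)
Lemma spec_commute B xi : measurable B -> X (E B xi) = E B (X xi).
Proof.
move=> mB; have mC := measurableC mB.
have lE := spec_lin mB; have lC := spec_lin mC.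
have cross u v : rip (X (E B u)) (E (~` B) v) = 0.
  pose w := E B u + E (~` B) v.
  have Bw : E B w = E B u.
    by rewrite /w linD// (proj_idem (spec_proj mB)) spec_disjoint ?addr0// setICr.
  have Cw : E (~` B) w = E (~` B) v.
    by rewrite /w linD// (proj_idem (spec_proj mC)) spec_disjoint ?add0r// setIC setICr.
  have := spec_form_split w mB; rewrite Bw Cw /w (linD lX) !ripDl !ripDr.
  rewrite (adjoint_rip (E (~` B) v) _ sX) (ripC _ (E (~` B) v)); lra.
have BX u v : rip (E (~` B) (X (E B u))) v = 0.
  by rewrite (adjoint_rip _ _ (proj_sa (spec_proj mC))) cross.
have XB u : X (E B u) = E B (X (E B u)).
  apply/eqP; rewrite -subr_eq0 -specC//; apply/eqP/(nsq_eq0 (ip := ip)).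
  exact: BX.
have XC u : E B (X (E (~` B) u)) = 0.
  apply: (nsq_eq0 (ip := ip)); rewrite -(rip_proj (spec_proj mB)).
  rewrite (adjoint_rip _ _ (proj_sa (spec_proj mB))) (adjoint_rip _ _ sX) ripC.
  by rewrite cross.
rewrite XB -{2}(subrK (E B xi) xi) -specC// (linD lX) (linD lE) XC.
by rewrite add0r.
Qed.

End SpectralMeasure.
(** * Polynomial cut-offs *)

Section RealEstimates.
Context (R : realType).
Implicit Types x b : R.

Lemma bernoulli x n : 0 <= x <= 1 -> 1 - n%:R * x <= (1 - x) ^+ n.
Proof.
move=> /andP[x0 x1]; elim: n => [|n IH]; first by rewrite mul0r subr0.
rewrite exprS -natr1; apply: le_trans (ler_wpM2l _ IH); last by rewrite subr_ge0.
have : 0 <= n%:R * (x * x) by rewrite !mulr_ge0.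
lra.
Qed.

Lemma exprB_natM_le1 b n : 0 <= b <= 1 -> (1 - b) ^+ n * (1 + n%:R * b) <= 1.
Proof.
move=> /andP[b0 b1]; elim: n => [|n IH]; first by rewrite mul0r addr0 mulr1.
apply: le_trans IH; rewrite exprSr -mulrA; apply: ler_wpM2l.
  by rewrite exprn_ge0// subr_ge0.
have : 0 <= n%:R * (b * b) by rewrite !mulr_ge0.
rewrite -natr1; nra.
Qed.

Lemma geometric_small (r e : R) : 0 <= r < 1 -> 0 < e -> exists k, r ^+ k < e.
Proof.
move=> /andP[r0 r1] e0.
have cv : (fun n => r ^+ n) @ \oo --> (0 : R) by apply: cvg_expr; rewrite ger0_norm.
have [k _ /(_ k (leqnn k)) /= h] := cvgr_lt _ cv _ e0.
by exists k.
Qed.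

End RealEstimates.

Section GeneratedAlgebra.
Context (R : realType) (H : completeNormedModType R[i]) (X : H -> H).
Implicit Types S T : H -> H.

Local Notation alg := (@generated_algebra R H X).

Lemma alg_gen : alg X.
Proof. by move=> A [_ XA]; exact: XA. Qed.

Lemma alg_id : alg idfun.
Proof. by move=> A [[]]. Qed.

Lemma alg_comb c S T : alg S -> alg T -> alg (fun x => c *: S x + T x).
Proof. by move=> hS hT A hA; case: (hA) => -[_ + _] _; apply; [exact: hS|exact: hT]. Qed.

Lemma alg_comp S T : alg S -> alg T -> alg (S \o T).
Proof. by move=> hS hT A hA; case: (hA) => -[_ _ +] _; apply; [exact: hS|exact: hT]. Qed.

Lemma alg_scale c S : alg S -> alg (fun x => c *: S x).
Proof.
move=> hS; rewrite (_ : (fun x => _) = fun x => (c - 1) *: S x + S x).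
  exact: alg_comb.
by apply/funext => x; rewrite scalerBl scale1r subrK.
Qed.

Lemma alg_iter k S : alg S -> alg (iter k S).
Proof.
move=> hS; elim: k => [|k IH]; first exact: alg_id.
exact: (alg_comp hS IH).
Qed.

End GeneratedAlgebra.

Section Cutoff.
Context (R : realType) (H : completeNormedModType R[i]).
Context (ip : {dot H for Num.conj}).
Implicit Types (A B G P Q S T X : H -> H) (xi : H).

Local Notation rip := (rip ip).
Local Notation nsq := (nsq ip).

Definition positive_contraction A : Prop :=
  [/\ linear A, selfadjoint ip A & forall xi, 0 <= rip (A xi) xi <= nsq xi].

Lemma pcontr_nsq A xi : positive_contraction A -> nsq (A xi) <= rip (A xi) xi.
Proof.
move=> [lA sA fA]; rewrite -[leRHS]mul1r; apply: form_le_nsq => // y.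
by rewrite mul1r.
Qed.

Lemma pcontr_le A xi : positive_contraction A -> nsq (A xi) <= nsq xi.
Proof.
move=> hA; apply: (le_trans (pcontr_nsq xi hA)).
by case: hA => _ _ /(_ xi)/andP[].
Qed.

Lemma pcontr_iter_le A k xi : positive_contraction A -> nsq (iter k A xi) <= nsq xi.
Proof. by move=> hA; elim: k => //= k; apply: le_trans; exact: pcontr_le. Qed.

(** Even powers are positive, and their form is a squared norm. *)
Lemma rip_iter2 A k xi : selfadjoint ip A ->
  rip (iter (k + k) A xi) xi = nsq (iter k A xi).
Proof. by move=> sA; rewrite iterD (adjoint_rip _ _ (selfadjoint_iter k sA)). Qed.

Lemma pcontr_iter2 A k : positive_contraction A ->
  positive_contraction (iter (k + k) A).
Proof.
move=> hA; case: (hA) => lA sA _; split.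
- exact: linear_iter.
- exact: selfadjoint_iter.
- by move=> xi; rewrite rip_iter2// nsq_ge0 pcontr_iter_le.
Qed.

Definition compl A : H -> H := fun x => x - A x.

Lemma linear_compl A : linear A -> linear (compl A).
Proof.
move=> lA c x y; rewrite /compl (linD lA) (linZ _ _ lA) scalerBr opprD.
by rewrite addrACA.
Qed.

Lemma selfadjoint_compl A : selfadjoint ip A -> selfadjoint ip (compl A).
Proof. by move=> sA x y; rewrite /compl ipBl ipBr sA. Qed.

Lemma rip_compl A xi : rip (compl A xi) xi = nsq xi - rip (A xi) xi.
Proof. by rewrite /compl ripDl ripNl. Qed.

Lemma pcontr_compl A : positive_contraction A -> positive_contraction (compl A).
Proof.
move=> [lA sA fA]; split.
- exact: linear_compl.
- exact: selfadjoint_compl.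
- by move=> xi; rewrite rip_compl; have := fA xi; lra.
Qed.

Section Invariant.
Context A P (hA : positive_contraction A) (hP : orth_proj ip P).
Hypothesis AP : forall x, A (P x) = P (A x).

Lemma iter_fix k xi : P xi = xi -> P (iter k A xi) = iter k A xi.
Proof. by move=> Pxi; rewrite -(iter_commute k AP) Pxi. Qed.

Lemma iter_norm_le (c : R) k xi : 0 < c ->
  (forall x, P x = x -> rip (A x) x <= c * nsq x) -> P xi = xi ->
  nsq (iter k A xi) <= c ^+ (k + k) * nsq xi.
Proof.
move=> c0 Ac Pxi; case: (hA) => lA sA fA; have lP := proj_linear hP.
have AP_le x : P x = x -> nsq (A x) <= c ^+ 2 * nsq x.
  move=> Px; rewrite -{1}Px.
  apply: (@form_le_norm _ _ _ (A \o P)) => //; first exact: linear_comp_op.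
    by move=> y z; rewrite /= sA (proj_sa hP) AP.
  move=> y /=; rewrite AP (rip_proj_l hP) -AP.
  have := Ac (P y) (proj_idem hP y); have /andP[-> _] /= := fA (P y).
  move/le_trans; apply; apply: ler_wpM2l; first exact: ltW.
  exact: nsq_proj_le.
elim: k => [|k IH]; first by rewrite expr0 mul1r.
rewrite iterS; apply: (le_trans (AP_le _ (iter_fix k Pxi))).
have -> : c ^+ (k.+1 + k.+1) = c ^+ 2 * c ^+ (k + k) by rewrite -exprD addSn addnS.
by rewrite -mulrA ler_wpM2l// sqr_ge0.
Qed.

Lemma iter_norm_ge (c : R) k xi : 0 <= c ->
  (forall x, P x = x -> c * nsq x <= rip (A x) x) -> P xi = xi ->
  c ^+ (k + k) * nsq xi <= nsq (iter k A xi).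
Proof.
move=> c0 Ac Pxi; elim: k => [|k IH]; first by rewrite expr0 mul1r.
rewrite iterS; apply: le_trans (form_ge_norm c0 (Ac _ (iter_fix k Pxi))).
have -> : c ^+ (k.+1 + k.+1) = c ^+ 2 * c ^+ (k + k) by rewrite -exprD addSn addnS.
by rewrite -mulrA ler_wpM2l// sqr_ge0.
Qed.

End Invariant.

(** [bump G k] is the value at [G] of the polynomial
    [(1 - y ^ (2 k)) ^ (2 * 4 ^ k)]. On the unit interval these polynomials tend
    to [1] below [1 / 2] and to [0] above, as [4 ^ k] is the inverse of
    [y ^ (2 k)] at [1 / 2]. *)
Definition bump G k : H -> H := iter (4 ^ k + 4 ^ k) (compl (iter (k + k) G)).

Section Bump.
Context G (hG : positive_contraction G).

Lemma pcontr_bump k : positive_contraction (bump G k).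
Proof. exact/pcontr_iter2/pcontr_compl/pcontr_iter2. Qed.

Context P (hP : orth_proj ip P) (GP : forall x, G (P x) = P (G x)).

Lemma compl_iter_commute k x :
  compl (iter (k + k) G) (P x) = P (compl (iter (k + k) G) x).
Proof. by rewrite /compl (iter_commute _ GP) (linB (proj_linear hP)). Qed.

(** If [G <= c] on the range of [P], then [1 - G ^ (2 k) >= 1 - c ^ (2 k)] there,
    and Bernoulli's inequality bounds the power of the right-hand side below. *)
Lemma bump_low (c : R) k xi : 0 < c <= 1 ->
  (forall x, P x = x -> rip (G x) x <= c * nsq x) -> P xi = xi ->
  nsq (xi - bump G k xi) <= 4 * (4 * c ^+ 2) ^+ k * nsq xi.
Proof.
move=> /andP[c0 c1] Gc Pxi; set a : R := c ^+ (k + k).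
have a01 : 0 <= a <= 1 by rewrite exprn_ge0 ?exprn_ile1// ltW.
have B_ge x : P x = x -> (1 - a) * nsq x <= rip (compl (iter (k + k) G) x) x.
  move=> Px; rewrite rip_compl rip_iter2; last by case: hG.
  rewrite mulrBl mul1r lerD2l lerN2.
  exact: (iter_norm_le hG hP GP).
have a1 : 0 <= 1 - a by rewrite subr_ge0; case/andP: a01.
have := iter_norm_ge (@compl_iter_commute k) (4 ^ k + 4 ^ k) a1 B_ge Pxi.
rewrite -/(bump G k) => h_ge.
have := pcontr_nsq xi (pcontr_bump k); rewrite nsqB ripC => h_form.
have := bernoulli (4 ^ k + 4 ^ k + (4 ^ k + 4 ^ k)) a01.
move=> /(ler_wpM2r (nsq_ge0 ip xi)) /le_trans /(_ h_ge).
have -> : (4 ^ k + 4 ^ k + (4 ^ k + 4 ^ k))%:R * a = 4 * (4 * c ^+ 2) ^+ k.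
  by rewrite !natrD natrX exprMn -exprM mul2n -addnn -/a; ring.
lra.
Qed.

(** If [c <= G] on the range of [P], then [1 - G ^ (2 k) <= 1 - b] there with
    [b := c ^ (2 k)], and [(1 - b) ^ (4 ^ k) <= 1 / (4 ^ k b)]. *)
Lemma bump_high (c : R) k xi : 0 < c < 1 -> (0 < k)%N ->
  (forall x, P x = x -> c * nsq x <= rip (G x) x) -> P xi = xi ->
  nsq (bump G k xi) <= (4 * c ^+ 2) ^- k * nsq xi.
Proof.
move=> /andP[c0 c1] k0 Gc Pxi; set b : R := c ^+ (k + k).
have b0 : 0 < b by rewrite exprn_gt0.
have b1 : b < 1.
  by rewrite exprn_ilt1 ?(ltW c0)// addnn double_eq0 -lt0n.
have B_le x : P x = x -> rip (compl (iter (k + k) G) x) x <= (1 - b) * nsq x.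
  move=> Px; rewrite rip_compl rip_iter2; last by case: hG.
  rewrite mulrBl mul1r lerD2l lerN2.
  by apply: (iter_norm_ge GP) => //; exact: ltW.
have b1' : 0 < 1 - b by rewrite subr_gt0.
have hB := pcontr_compl (pcontr_iter2 k hG).
have := iter_norm_le hB hP (@compl_iter_commute k) (4 ^ k + 4 ^ k) b1' B_le Pxi.
rewrite -/(bump G k) => /le_trans; apply; apply: ler_wpM2r; first exact: nsq_ge0.
have bE : (4 ^ k)%:R * b = (4 * c ^+ 2) ^+ k.
  by rewrite natrX exprMn -exprM mul2n -addnn.
have d0 : 0 < (4 ^ k)%:R * b by rewrite mulr_gt0// ltr0n expn_gt0.
rewrite -bE -[leRHS]mul1r ler_pdivlMr//.
have : (1 - b) ^+ (4 ^ k) * (1 + (4 ^ k)%:R * b) <= 1.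
  by apply: exprB_natM_le1; rewrite (ltW b0) (ltW b1).
apply: le_trans; apply: ler_pM.
- by rewrite exprn_ge0 // ltW.
- exact: ltW.
- apply: ler_wiXn2l; [exact: ltW| |exact: (leq_trans (leq_addr _ _) (leq_addr _ _))].
  by rewrite gerBl ltW.
- by rewrite lerDr.
Qed.

End Bump.

Hypothesis hH : hilbert_norm ip.
Context (X : H -> H) (E : set R -> H -> H).
Hypotheses (hE : is_spectral_measure ip X E)
  (bX : bounded_operators X) (sX : selfadjoint ip X).

(** Rescale [X] so that the threshold [t] becomes [1 / 2] and the form lies
    between [0] and [1]; then cut off with [bump]. *)
Lemma spectral_cutoff (t d e : R) : 0 < d -> 0 < e ->
  exists h, [/\ generated_algebra X h, positive_contraction h,
    forall xi, E `]-oo, (t - d)] xi = xi -> nsq (xi - h xi) <= e * nsq xi &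
    forall xi, E `]t + d, +oo[ xi = xi -> nsq (h xi) <= e * nsq xi].
Proof.
move=> d0 e0; have lX : linear X by case: bX.
have [C C0 XC] := bounded_nsq hH bX.
pose K : R := (C + 1) / 2; have K0 : 0 < K by rewrite /K; lra.
have X_le xi : rip (X xi) xi <= K * nsq xi.
  by have := XC xi; have := nsq_ge0 ip (X xi - xi); rewrite nsqB /K; lra.
have X_ge xi : - (K * nsq xi) <= rip (X xi) xi.
  by have := XC xi; have := nsq_ge0 ip (X xi + xi); rewrite nsqD /K; lra.
(* [K] bounds the form of [X]; the half-width [L] of the window around [t] must
   contain the spectrum and exceed [d]. *)
pose L : R := K + `|t| + d + 1.
have Lt : `|t| + K + d < L by rewrite /L; lra.
have L0 : 0 < L by have := normr_ge0 t; lra.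
pose c : R := (2 * L)^-1; have c0 : 0 < c by rewrite invr_gt0 mulr_gt0.
have cL : c * L = 1 / 2 by rewrite /c; field; rewrite gt_eqF.
pose G : H -> H := fun x => c%:C *: X x + (c * (L - t))%:C *: x.
have GE xi : rip (G xi) xi = c * (rip (X xi) xi + (L - t) * nsq xi).
  rewrite /G !ripE -/(nsq xi); ring.
have algG : generated_algebra X G.
  exact: (alg_comb _ (@alg_gen _ _ X) (alg_scale _ (@alg_id _ _ X))).
have /andP[tL1 tL2] : - `|t| <= t <= `|t| by rewrite -ler_norml.
have hG : positive_contraction G.
  split.
  - by apply: linear_comb_op => // k x y; rewrite scalerDr !scalerA mulrC.
  - move=> x y; rewrite /G ipDl ipDr !ipZl !ipZr sX.
    by rewrite !conj_realC.
  - move=> xi; rewrite GE; have n0 := nsq_ge0 ip xi.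
    apply/andP; split.
      apply: mulr_ge0; first exact: ltW.
      have := X_ge xi; have : 0 <= (L - t - K) * nsq xi.
        by rewrite mulr_ge0//; lra.
      lra.
    rewrite -(ler_pM2l (mulr_gt0 (ltr0Sn R 1) L0)) mulrA mulfV ?mul1r ?gt_eqF ?mulr_gt0//.
    have := X_le xi; have : 0 <= (L + t - K) * nsq xi.
      by rewrite mulr_ge0//; lra.
    lra.
have GE_comm (B : set R) x : measurable B -> G (E B x) = E B (G x).
  move=> mB; rewrite /G (spec_commute hE)//.
  by have lB := spec_lin hE mB; rewrite (linD lB) !(linZ _ _ lB).
(* On the two sides the form of [G] is at distance [z] from [1 / 2], and both
   errors of [bump] are controlled by the powers of [r ^ 2]. *)
pose z : R := c * d; have z0 : 0 < z by rewrite mulr_gt0.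
have z1 : z < 1 / 2.
  by rewrite -cL /z ltr_pM2l//; have := normr_ge0 t; lra.
pose r : R := (1 + 2 * z)^-1.
have r0 : 0 < r by rewrite invr_gt0; lra.
have r1 : r < 1 by rewrite invf_lt1; lra.
have e4 : 0 < e / 4 by rewrite divr_gt0.
have [|k hk] := @geometric_small _ (r ^+ 2) (e / 4) _ e4.
  by rewrite sqr_ge0 /= exprn_ilt1// ltW.
have {}hk : 4 * (r ^+ 2) ^+ k.+1 <= e.
  rewrite exprS; have q0 : 0 <= (r ^+ 2) ^+ k by rewrite !exprn_ge0// ltW.
  have : r ^+ 2 * (r ^+ 2) ^+ k <= 1 * (r ^+ 2) ^+ k.
    by rewrite ler_wpM2r// exprn_ile1// ltW.
  lra.
exists (bump G k.+1); split.
- apply: alg_iter; rewrite (_ : compl _ = fun x => (-1) *: iter (k.+1 + k.+1) G x + idfun x).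
    exact: (alg_comb _ (alg_iter _ algG) (@alg_id _ _ X)).
  by apply/funext => x; rewrite /compl scaleN1r addrC.
- exact: pcontr_bump.
- move=> xi xiE.
  have mB : measurable (`]-oo, (t - d)]%classic : set R) by [].
  have c01 : 0 < 1 / 2 - z <= 1 by lra.
  apply: (le_trans (bump_low hG (spec_proj hE mB) (fun x => GE_comm _ x mB) _ c01 _ xiE)).
    move=> x xE; rewrite GE.
    have := @spec_form_le _ _ _ _ _ hE _ (t - d) x mB _ xE.
    rewrite (_ : 1 / 2 - z = c * (L - d)); last by rewrite /z mulrBr cL.
    move=> hx; rewrite -mulrA ler_pM2l//.
    have {}hx := hx (fun y => ltac:(by rewrite /= in_itv)); lra.
  apply: ler_wpM2r; first exact: nsq_ge0.
  apply: le_trans hk; rewrite ler_pM2l//; apply: lerXn2r; rewrite ?nnegrE//.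
    by rewrite mulr_ge0// sqr_ge0.
    by rewrite sqr_ge0.
  rewrite (_ : 4 * _ = (1 - 2 * z) ^+ 2); last by field.
  apply: lerXn2r; rewrite ?nnegrE; [lra|exact: ltW|].
  rewrite /r -[leRHS]mul1r ler_pdivlMr; last by lra.
  have := sqr_ge0 z; lra.
- move=> xi xiE.
  have mB : measurable (`]t + d, +oo[%classic : set R) by [].
  have c01 : 0 < 1 / 2 + z < 1 by lra.
  apply: (le_trans (bump_high hG (spec_proj hE mB) (fun x => GE_comm _ x mB) c01 _ _ xiE)) => //.
    move=> x xE; rewrite GE.
    have := @spec_form_ge _ _ _ _ _ hE _ (t + d) x mB _ xE.
    rewrite (_ : 1 / 2 + z = c * (L + d)); last by rewrite /z mulrDr cL.
    move=> hx; rewrite -mulrA ler_pM2l//.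
    have {}hx := hx (fun y => ltac:(by rewrite /= in_itv /= andbT => /ltW)); lra.
  apply: ler_wpM2r; first exact: nsq_ge0.
  apply: le_trans hk.
  rewrite (_ : 4 * _ = (1 + 2 * z) ^+ 2); last by field.
  rewrite -exprVn -exprVn -/r ler_peMl ?exprn_ge0 ?ltW//; lra.
Qed.

End Cutoff.
(** * Membership in a von Neumann algebra *)

Section Commutation.
Context (R : realType) (H : completeNormedModType R[i]).
Context (ip : {dot H for Num.conj}) (hH : hilbert_norm ip).
Implicit Types (S T : H -> H) (B : set R) (xi : H) (a b : R).

Local Notation rip := (rip ip).
Local Notation nsq := (nsq ip).

Lemma le0_of_small (x K : R) : (forall e, 0 < e -> x <= e * K) -> x <= 0.
Proof.
move=> h; rewrite leNgt; apply/negP => x0.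
pose d : R := 2 * (`|K| + 1).
have d0 : 0 < d by have := normr_ge0 K; rewrite /d; lra.
have q0 := divr_gt0 x0 d0; have := h _ q0.
have : x / d * K <= x / d * (d / 2).
  by rewrite ler_pM2l// /d; have := ler_norm K; lra.
have -> : x / d * (d / 2) = x / 2 by field; rewrite gt_eqF.
lra.
Qed.

Lemma alg_commute X T h : linear T -> (forall x, T (X x) = X (T x)) ->
  generated_algebra X h -> forall x, T (h x) = h (T x).
Proof.
move=> lT TX hX; apply: (hX [set S | forall x, T (S x) = S (T x)]).
split; last by move=> _ ->.
split=> // [c S S' hS hS' x|S S' hS hS' x /=]; last by rewrite hS hS'.
by rewrite (linD lT) (linZ _ _ lT) hS hS'.
Qed.

Context (X : H -> H) (E : set R -> H -> H).
Hypotheses (hE : is_spectral_measure ip X E)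
  (bX : bounded_operators X) (sX : selfadjoint ip X).

Lemma spec_itv a b xi : a <= b ->
  E `]a, b] xi = E `]a, +oo[ xi - E `]b, +oo[ xi.
Proof.
move=> ab; rewrite -[in RHS](@spec_sub _ _ _ _ _ hE `]b, +oo[ `]a, +oo[)//; last first.
  by move=> x; rewrite /= !in_itv /= !andbT; exact: le_lt_trans.
rewrite -(linB (spec_lin hE _))// -(specC hE)// (specI hE)//; last exact: measurableC.
rewrite setCitvr; congr (E _ xi); apply/seteqP.
by split=> x; rewrite /= !in_itv /= ?andbT; [move=> /andP[]|move=> [-> ->]].
Qed.

Lemma spec_le_gt a xi : E `]-oo, a] xi = xi - E `]a, +oo[ xi.
Proof. by rewrite -(specC hE)// setCitvr. Qed.

Section OneOperator.
Context T (bT : bounded_operators T) (TX : forall x, T (X x) = X (T x)).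

(** Between separated parts of the spectrum, the cut-off is nearly [1] on one
    side and nearly [0] on the other, and it commutes with [T]. *)
Lemma spec_sep_commute a b xi : a < b ->
  E `]-oo, a] (T (E `]b, +oo[ xi)) = 0 /\ E `]b, +oo[ (T (E `]-oo, a] xi)) = 0.
Proof.
move=> ab; have lX : linear X by case: bX.
have lT : linear T by case: bT.
have [C C0 TC] := bounded_nsq hH bT.
pose t := (a + b) / 2; pose d := (b - a) / 2.
have d0 : 0 < d by rewrite /d; lra.
have ta : t - d = a by rewrite /t /d; field.
have tb : t + d = b by rewrite /t /d; field.
have mP : measurable (`]-oo, a]%classic : set R) by [].
have mQ : measurable (`]b, +oo[%classic : set R) by [].
have hP := spec_proj hE mP; have hQ := spec_proj hE mQ.
set P := E _ in hP *; set Q := E `]b, +oo[ in hQ *.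
have commE h B : measurable B -> generated_algebra X h ->
    forall x, E B (h x) = h (E B x).
  move=> mB hX; apply: (alg_commute (spec_lin hE mB) _ hX) => x.
  by rewrite (spec_commute hE).
split; apply: (@nsq_le0 _ _ ip).
- set eta := P _; set zeta := Q xi.
  apply: (@le0_of_small _ (2 * (nsq eta + C * nsq zeta))) => e e0.
  have [h [hX _ hlow hhigh]] := spectral_cutoff hH hE bX sX t d0 e0.
  rewrite ta tb in hlow hhigh.
  have h1 : nsq (eta - h eta) <= e * nsq eta by apply/hlow/(proj_idem hP).
  have h2 : nsq (h zeta) <= e * nsq zeta by apply/hhigh/(proj_idem hQ).
  have h3 : nsq (h eta) <= C * (e * nsq zeta).
    rewrite -(commE _ _ mP hX) -(alg_commute lT TX hX).
    apply: (le_trans (nsq_proj_le hP _)); apply: (le_trans (TC _)).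
    by rewrite ler_pM2l.
  have := nsqD_le ip (eta - h eta) (h eta); rewrite subrK; lra.
- set eta := Q _; set zeta := P xi.
  apply: (@le0_of_small _ (2 * (nsq eta + C * nsq zeta))) => e e0.
  have [h [hX _ hlow hhigh]] := spectral_cutoff hH hE bX sX t d0 e0.
  rewrite ta tb in hlow hhigh.
  have h1 : nsq (h eta) <= e * nsq eta by apply/hhigh/(proj_idem hQ).
  have h2 : nsq (zeta - h zeta) <= e * nsq zeta by apply/hlow/(proj_idem hP).
  have h3 : nsq (eta - h eta) <= C * (e * nsq zeta).
    rewrite -(commE _ _ mQ hX) -(alg_commute lT TX hX).
    rewrite -(linB (proj_linear hQ)) -(linB lT).
    apply: (le_trans (nsq_proj_le hQ _)); apply: (le_trans (TC _)).
    by rewrite ler_pM2l.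
  have := nsqD_le ip (eta - h eta) (h eta); rewrite subrK; lra.
Qed.

(** By right-continuity of the resolution of the identity, the gap between the two
    half-lines can be closed. *)
Lemma spec_commutant a xi : T (E `]a, +oo[ xi) = E `]a, +oo[ (T xi).
Proof.
have lT : linear T by case: bT.
have [C C0 TC] := bounded_nsq hH bT.
have mP : measurable (`]-oo, a]%classic : set R) by [].
have mQ : measurable (`]a, +oo[%classic : set R) by [].
have hP := spec_proj hE mP; have hQ := spec_proj hE mQ.
have h1 : E `]-oo, a] (T (E `]a, +oo[ xi)) = 0.
  apply: (@nsq_le0 _ _ ip); apply: (@le0_of_small _ C) => e e0.
  have [b ab hb] := spec_right_cont hE a xi e0.
  have -> : E `]a, +oo[ xi = E `]a, b] xi + E `]b, +oo[ xi.
    by rewrite spec_itv ?ltW// subrK.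
  rewrite (linD lT) (linD (proj_linear hP)).
  rewrite (proj1 (spec_sep_commute xi ab)) addr0.
  apply: (le_trans (nsq_proj_le hP _)); apply: (le_trans (TC _)).
  by rewrite mulrC ler_pM2r// ltW.
have h2 : E `]a, +oo[ (T (E `]-oo, a] xi)) = 0.
  apply: (@nsq_le0 _ _ ip); apply: (@le0_of_small _ 1) => e e0.
  set eta := T _.
  have [b ab hb] := spec_right_cont hE a eta e0.
  have -> : E `]a, +oo[ eta = E `]a, b] eta + E `]b, +oo[ eta.
    by rewrite spec_itv ?ltW// subrK.
  by rewrite (proj2 (spec_sep_commute xi ab)) addr0 mulr1 ltW.
move: h1 h2; rewrite !spec_le_gt (linB lT) (linB (proj_linear hQ)).
by move=> /subr0_eq h1 /subr0_eq ->.
Qed.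

End OneOperator.
End Commutation.

Section Join.
Context (R : realType) (H : completeNormedModType R[i]).
Context (ip : {dot H for Num.conj}) (hH : hilbert_norm ip).
Context (P Q S : H -> H).
Hypotheses (hP : orth_proj ip P) (hQ : orth_proj ip Q)
  (hS : proj_join ip P Q S).
Implicit Types (T : H -> H) (x y : H).

Local Notation rip := (rip ip).
Local Notation nsq := (nsq ip).

Lemma join_proj : orth_proj ip S. Proof. by case: hS. Qed.

Lemma join_dense x (e : R) : S x = x -> 0 < e ->
  exists p q, nsq (x - (P p + Q q)) < e.
Proof.
move=> Sx e0; have : range S x by exists x.
case: hS => _ -> /(closureP_nsq hH)/(_ _ e0)[_ [_ [p _ <-] [_ [q _ <-] <-]] h].
by exists p, q.
Qed.

Lemma join_fixl x : S (P x) = P x.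
Proof.
apply/(range_projE join_proj); case: hS => _ ->; apply: subset_closure.
exists (P x); first by exists x.
by exists 0; [exists 0 => //; exact: lin0 (proj_linear hQ)|rewrite addr0].
Qed.

Lemma join_fixr x : S (Q x) = Q x.
Proof.
apply/(range_projE join_proj); case: hS => _ ->; apply: subset_closure.
exists 0; first by exists 0 => //; exact: lin0 (proj_linear hP).
by exists (Q x); [exists x|rewrite add0r].
Qed.

Lemma join_absorbl x : P (S x) = P x.
Proof.
have lP := proj_linear hP; have lS := proj_linear join_proj.
apply/eqP; rewrite -subr_eq0 -(linB lP); apply/eqP/(nsq_eq0 (ip := ip)).
have <- : rip (S (S x - x)) (P (S x - x)) = nsq (P (S x - x)).
  by rewrite (adjoint_rip _ _ (proj_sa join_proj)) join_fixl ripC (rip_proj hP).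
by rewrite (linB lS) (proj_idem join_proj) subrr rip0l.
Qed.

Lemma join_absorbr x : Q (S x) = Q x.
Proof.
have lQ := proj_linear hQ; have lS := proj_linear join_proj.
apply/eqP; rewrite -subr_eq0 -(linB lQ); apply/eqP/(nsq_eq0 (ip := ip)).
have <- : rip (S (S x - x)) (Q (S x - x)) = nsq (Q (S x - x)).
  by rewrite (adjoint_rip _ _ (proj_sa join_proj)) join_fixr ripC (rip_proj hQ).
by rewrite (linB lS) (proj_idem join_proj) subrr rip0l.
Qed.

(** A vector killed by [P] and [Q] is orthogonal to both ranges. *)
Lemma join_ker x : P x = 0 -> Q x = 0 -> S x = 0.
Proof.
move=> Px Qx; apply: (@nsq_le0 _ _ ip); apply: (@le0_of_small _ _ 1) => e e0.
have [p [q h]] := join_dense (proj_idem join_proj x) e0.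
rewrite mulr1; apply: ltW; apply: le_lt_trans h.
rewrite nsqB ripDr (adjoint_rip _ _ (proj_sa join_proj)) join_fixl.
rewrite (adjoint_rip _ _ (proj_sa join_proj)) join_fixr.
rewrite -(adjoint_rip _ _ (proj_sa hP)) -(adjoint_rip _ _ (proj_sa hQ)) Px Qx.
by rewrite !rip0l addr0 mulr0 subr0 lerDl nsq_ge0.
Qed.

(** [T] preserves both the range of the join, as a closed span of preserved
    subspaces, and its kernel, as the intersection of the two kernels. *)
Lemma join_commute T : bounded_operators T ->
  (forall x, T (P x) = P (T x)) -> (forall x, T (Q x) = Q (T x)) ->
  forall x, T (S x) = S (T x).
Proof.
move=> bT TP TQ x; have lT : linear T by case: bT.
have lS := proj_linear join_proj.
have [C C0 TC] := bounded_nsq hH bT.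
have h1 : S (T (S x)) = T (S x).
  apply/eqP; rewrite eq_sym -subr_eq0; apply/eqP/(@nsq_le0 _ _ ip).
  apply: (@le0_of_small _ _ C) => e e0.
  have [p [q h]] := join_dense (proj_idem join_proj x) e0.
  set z := T (S x); set y := T (P p + Q q).
  have Sy : S y = y by rewrite /y (linD lT) TP TQ (linD lS) join_fixl join_fixr.
  have := nsq_proj_split join_proj (z - y); rewrite (linB lS) Sy.
  have -> : z - y - (S z - y) = z - S z by rewrite opprB addrA subrK.
  have : nsq (z - y) <= C * e.
    by rewrite -(linB lT) (le_trans (TC _))// ler_pM2l// ltW.
  have := nsq_ge0 ip (S z - y); lra.
have h2 : S (T (x - S x)) = 0.
  apply: join_ker.
    by rewrite -TP (linB (proj_linear hP)) join_absorbl subrr (lin0 lT).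
  by rewrite -TQ (linB (proj_linear hQ)) join_absorbr subrr (lin0 lT).
by move: h2; rewrite (linB lT) (linB lS) h1 => /subr0_eq ->.
Qed.

End Join.

Section VonNeumann.
Context (R : realType) (H : completeNormedModType R[i]).
Context (ip : {dot H for Num.conj}) (hH : hilbert_norm ip).
Context (M : set (H -> H)) (hM : von_neumann_algebra ip M).
Implicit Types (A B P Q S T : H -> H).

Lemma vn_bounded A : M A -> bounded_operators A.
Proof. by case: hM => + _ _; apply. Qed.

Lemma vn_lin A : M A -> linear A.
Proof. by move/vn_bounded => []. Qed.

(** Membership is tested by commutation, [M] being its own bicommutant. *)
Lemma vnP A : bounded_operators A ->
  (forall T, commutant M T -> forall x, T (A x) = A (T x)) -> M A.
Proof.
move=> bA hA; case: hM => _ _ <-; split=> // T MT.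
by apply/funext => x /=; rewrite hA.
Qed.

Lemma vn_commute A T x : M A -> commutant M T -> T (A x) = A (T x).
Proof. by move=> MA [_ /(_ _ MA)/(f_equal (@^~ x))]. Qed.

Lemma vn_comm_lin T : commutant M T -> linear T.
Proof. by case=> -[]. Qed.

Lemma vn_id : M idfun.
Proof. by apply: vnP => //; exact: bounded_id. Qed.

Lemma vn_comb c A B : M A -> M B -> M (fun x => c *: A x + B x).
Proof.
move=> MA MB; apply: vnP => [|T MT x]; first by apply: bounded_comb; exact: vn_bounded.
have lT := vn_comm_lin MT.
by rewrite (linD lT) (linZ _ _ lT) (vn_commute _ MA MT) (vn_commute _ MB MT).
Qed.

Lemma vn_comp A B : M A -> M B -> M (A \o B).
Proof.
move=> MA MB; apply: vnP => [|T MT x]; first by apply: bounded_comp; exact: vn_bounded.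
by rewrite /= (vn_commute _ MA MT) (vn_commute _ MB MT).
Qed.

Lemma vn_iter k A : M A -> M (iter k A).
Proof.
move=> MA; elim: k => [|k IH]; first exact: vn_id.
exact: (vn_comp MA IH).
Qed.

Lemma vn_scale c A : M A -> M (fun x => c *: A x).
Proof.
move=> MA; rewrite (_ : (fun x => _) = fun x => (c - 1) *: A x + A x).
  exact: vn_comb.
by apply/funext => x; rewrite scalerBl scale1r subrK.
Qed.

Lemma vn_sub A B : M A -> M B -> M (fun x => A x - B x).
Proof.
move=> MA MB; rewrite (_ : (fun x => _) = fun x => (-1) *: B x + A x).
  exact: vn_comb.
by apply/funext => x; rewrite scaleN1r addrC.
Qed.

Lemma vn_compl A : M A -> M (compl A).
Proof. by move=> MA; apply: vn_sub => //; exact: vn_id. Qed.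

Lemma vn_zero : M (fun=> 0).
Proof.
rewrite (_ : (fun=> 0) = fun x : H => idfun x - idfun x).
  by apply: vn_sub; exact: vn_id.
by apply/funext => x; rewrite subrr.
Qed.

Lemma vn_spec X (E : set R -> H -> H) (a : R) :
  M X -> selfadjoint ip X -> is_spectral_measure ip X E ->
  M (E `]a, +oo[%classic).
Proof.
move=> MX sX hE; apply: vnP => [|T MT x].
  have mB : measurable (`]a, +oo[%classic : set R) by exact: measurable_itv.
  exact: (proj_bounded (spec_proj hE mB)).
have TX y : T (X y) = X (T y) by exact: vn_commute MX MT.
case: MT => bT _; exact: (spec_commutant hH hE (vn_bounded MX) sX bT TX a x).
Qed.

Lemma vn_join P Q S : orth_proj ip P -> orth_proj ip Q -> proj_join ip P Q S ->
  M P -> M Q -> M S.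
Proof.
move=> hP hQ hS MP MQ; apply: vnP => [|T MT].
  exact: proj_bounded (join_proj hS).
apply: (join_commute hH hP hQ hS); first by case: MT.
- by move=> x; exact: vn_commute MP MT.
- by move=> x; exact: vn_commute MQ MT.
Qed.

End VonNeumann.
(** * The trace, and its subadditivity on projections *)

Section Trace.
Context (R : realType) (H : completeNormedModType R[i]).
Context (ip : {dot H for Num.conj}) (hH : hilbert_norm ip).
Context (M : set (H -> H)) (tau : (H -> H) -> R[i]).
Hypothesis hM : tracial_Wstar_probability_space ip M tau.
Implicit Types (A B C D P Q S T X Z : H -> H).

Local Notation rip := (rip ip).
Local Notation nsq := (nsq ip).

Definition rtau A : R := complex.Re (tau A).

Lemma trace_vn : von_neumann_algebra ip M. Proof. by case: hM. Qed.

Let hvn := trace_vn.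

Lemma tau_comb c A B : M A -> M B ->
  tau (fun x => c *: A x + B x) = c * tau A + tau B.
Proof. by case: hM => _ [[+ _ _] _ _ _]; apply. Qed.

Lemma tau_id : tau idfun = 1.
Proof. by case: hM => _ [[_ _ +] _ _ _]. Qed.

Lemma tauB A B : M A -> M B -> tau (fun x => A x - B x) = tau A - tau B.
Proof.
move=> MA MB; rewrite addrC -mulN1r -tau_comb//; congr tau.
by apply/funext => x; rewrite scaleN1r addrC.
Qed.

Lemma tau0 : tau (fun=> 0) = 0.
Proof.
have Mid := vn_id hvn; rewrite -(subrr (tau idfun)) -tauB//; congr tau.
by apply/funext => x; rewrite subrr.
Qed.

Lemma tauZ c A : M A -> tau (fun x => c *: A x) = c * tau A.
Proof.
move=> MA; have M0 := vn_zero hvn.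
rewrite -[RHS]addr0 -tau0 -tau_comb//; congr tau.
by apply/funext => x; rewrite addr0.
Qed.

Lemma tau_compl A : M A -> tau (compl A) = 1 - tau A.
Proof. by move=> MA; rewrite -tau_id -tauB//; exact: vn_id hvn. Qed.

Lemma rtau_compl A : M A -> rtau (compl A) = 1 - rtau A.
Proof. by move=> MA; rewrite /rtau tau_compl// ReB. Qed.

Lemma rtau0 : rtau (fun=> 0) = 0. Proof. by rewrite /rtau tau0. Qed.

Lemma rtau_id : rtau idfun = 1. Proof. by rewrite /rtau tau_id. Qed.

Lemma rtauB A B : M A -> M B -> rtau (fun x => A x - B x) = rtau A - rtau B.
Proof. by move=> MA MB; rewrite /rtau tauB// ReB. Qed.

Lemma rtauZ (a : R) A : M A -> rtau (fun x => a%:C *: A x) = a * rtau A.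
Proof. by move=> MA; rewrite /rtau tauZ// ReZ. Qed.

Lemma rtau_comb (a : R) A B : M A -> M B ->
  rtau (fun x => a%:C *: A x + B x) = a * rtau A + rtau B.
Proof. by move=> MA MB; rewrite /rtau tau_comb// ReD ReZ. Qed.

Lemma tau_cyc A B : M A -> M B -> tau (A \o B) = tau (B \o A).
Proof. by case: hM => _ [_ htr _ _]; exact: htr. Qed.

Lemma rtau_cyc A B : M A -> M B -> rtau (A \o B) = rtau (B \o A).
Proof. by move=> MA MB; rewrite /rtau tau_cyc. Qed.

Lemma tau_pos A : M A -> selfadjoint ip A -> (forall x, 0 <= rip (A x) x) ->
  tau A = (rtau A)%:C /\ 0 <= rtau A.
Proof.
move=> MA sA pA.
have p : 0 <= tau A.
  by case: hM => _ [[_ + _] _ _ _]; apply => //; exact: positive_op_rip.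
by split; [exact: ge0_ReK|exact: ge0_Re].
Qed.

Lemma rtau_le A B : M A -> M B -> selfadjoint ip A -> selfadjoint ip B ->
  (forall x, rip (A x) x <= rip (B x) x) -> rtau A <= rtau B.
Proof.
move=> MA MB sA sB AB; rewrite -subr_ge0 /rtau -ReB -tauB//.
apply: (proj2 (tau_pos (vn_sub hvn MB MA) _ _)) => [x y|x].
  by rewrite ipBl ipBr sA sB.
by rewrite ripDl ripNl subr_ge0.
Qed.

Lemma tau_proj P : M P -> orth_proj ip P ->
  tau P = (rtau P)%:C /\ 0 <= rtau P.
Proof.
move=> MP hP; apply: tau_pos => //; first exact: proj_sa hP.
by move=> x; rewrite (rip_proj hP) nsq_ge0.
Qed.

Lemma rtau_proj0 P : M P -> orth_proj ip P -> rtau P <= 0 -> P = (fun=> 0).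
Proof.
move=> MP hP P0; have [PE Pge] := tau_proj MP hP.
case: hM => _ [_ _ + _]; apply => //; first exact: proj_positive.
by rewrite PE; congr (_%:C); apply/eqP; rewrite eq_le P0.
Qed.

(** Cauchy-Schwarz for the scalar product of the trace: [tau] is nonnegative on
    [(D - mu C')^* (D - mu C')] for all [mu]. The values [1] and ['i] of [mu] show
    that [tau (D C')] is conjugate to [tau (C D)], after which [mu] is taken
    proportional to [tau (C D)]. The [+ 1] keeps the denominator of the
    proportionality factor away from [0]. *)
Lemma tau_cauchy_schwarz C C' D : M C -> M C' -> M D -> adjoint_of ip C C' ->
  selfadjoint ip D ->
  complex.Re (tau (C \o D)) ^+ 2 + complex.Im (tau (C \o D)) ^+ 2
    <= (rtau (C \o C') + 1) * rtau (D \o D).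
Proof.
move=> MC MC' MD CC' sD; have lC := vn_lin hvn MC; have lD := vn_lin hvn MD.
have mcomp := vn_comp hvn; have mcomb := vn_comb hvn.
have key mu : 0 <= (- mu) * tau (D \o C') + ((- Num.conj mu) * tau (C \o D)
    + ((Num.conj mu * mu) * tau (C \o C') + tau (D \o D))).
  have MDC := mcomp _ _ MD MC'; have MCD := mcomp _ _ MC MD.
  have MCC := mcomp _ _ MC MC'; have MDD := mcomp _ _ MD MD.
  have M1 := mcomb (Num.conj mu * mu) _ _ MCC MDD.
  have M2 := mcomb (- Num.conj mu) _ _ MCD M1.
  rewrite -!tau_comb//; case: (hM) => _ [[_ + _] _ _ _]; apply.
    exact: mcomb.
  move=> x; set y := D x - mu *: C' x.
  rewrite [X in ip X x](_ : _ = D y - Num.conj mu *: C y); last first.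
    rewrite /y (linB lD) (linB lC) (linZ _ _ lD) (linZ _ _ lC) /= !scaleNr.
    by rewrite scalerBr scalerA opprB [RHS](AC (2*2) (2*(4*(3*1))))%AC.
  have <- : ip y y = ip (D y - Num.conj mu *: C y) x.
    by rewrite [RHS]ipBl ipZl sD CC' {2}/y ipBr ipZr.
  by rewrite ipxx lecR nsq_ge0.
have [CE C0] : tau (C \o C') = (rtau (C \o C'))%:C /\ 0 <= rtau (C \o C').
  apply: tau_pos; first exact: mcomp.
    by move=> x y /=; rewrite CC' (adjointC CC').
  by move=> x /=; rewrite (adjoint_rip _ _ CC') nsq_ge0.
have [DE D0] : tau (D \o D) = (rtau (D \o D))%:C /\ 0 <= rtau (D \o D).
  apply: tau_pos; first exact: mcomp.
    by move=> x y /=; rewrite !sD.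
  by move=> x /=; rewrite (adjoint_rip _ _ sD) nsq_ge0.
move: key; rewrite CE DE; set k := rtau (C \o C') in C0 *.
set d := rtau (D \o D) in D0 *.
case: (tau (C \o D)) => a b; case: (tau (D \o C')) => p q key /=.
have := key 1; have := key 'i; rewrite !lecE /= => /andP[/eqP + _] /andP[/eqP + _].
move=> h1 h2; have {h1 h2} [pa qb] : p = a /\ q = - b by split; lra.
pose x : R := (k + 1)^-1; have x0 : 0 < x by rewrite invr_gt0; lra.
have xk : x * (k + 1) = 1 by rewrite mulVf// gt_eqF//; lra.
have := key (x *: a +i* (x *: b)).
rewrite lecE /= pa qb => /andP[_] {}key; set n := a ^+ 2 + b ^+ 2.
have n0 : 0 <= n by rewrite addr_ge0 ?sqr_ge0.
have {}key : 0 <= d - 2 * x * n + x ^+ 2 * k * n.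
  by apply: (le_trans key); rewrite /n /GRing.scale /=; nra.
have : x ^+ 2 * k * n <= x * n.
  apply: ler_wpM2r => //; rewrite expr2 -mulrA ger_pMr//; nra.
move=> h; have : x * n <= d by lra.
by rewrite -(ler_pM2l (_ : 0 < k + 1)) ?mulrA ?[(k + 1) * x]mulrC ?xk ?mul1r//; lra.
Qed.

(** ** Subadditivity *)

Section Subadditivity.
Context P Q S (hP : orth_proj ip P) (hQ : orth_proj ip Q).
Hypotheses (hS : proj_join ip P Q S) (MP : M P) (MQ : M Q).

Let lP := proj_linear hP.
Let lQ := proj_linear hQ.
Let hSp := join_proj hS.
Let lS := proj_linear hSp.
Let MS : M S := vn_join hH hvn hP hQ hS MP MQ.

Let Qc := compl Q.
(** The powers of the compression [X] of [1 - P] decrease to the projection on the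
    complement of the join, and [Z] accounts for the trace that they lose. *)
Let X : H -> H := Qc \o compl P \o Qc.
Let Z : H -> H := P \o Q \o P.

Let lQc : linear Qc := linear_compl lQ.
Let sQc : selfadjoint ip Qc := selfadjoint_compl (proj_sa hQ).

Lemma compl_proj_idem A x : orth_proj ip A -> compl A (compl A x) = compl A x.
Proof.
by move=> hA; rewrite /compl (linB (proj_linear hA)) (proj_idem hA) subrr subr0.
Qed.

Lemma nsq_compl A x : orth_proj ip A -> nsq (compl A x) = nsq x - nsq (A x).
Proof. by move=> hA; rewrite (nsq_proj_split hA x) /compl; ring. Qed.

Lemma compl_proj_le A x : orth_proj ip A -> nsq (compl A x) <= nsq x.
Proof. by move=> hA; rewrite nsq_compl// gerBl nsq_ge0. Qed.

Lemma Qc_idem x : Qc (Qc x) = Qc x.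
Proof. exact: compl_proj_idem. Qed.

Lemma X_in_M : M X.
Proof. by do ?[exact: (vn_compl hvn) | apply: (vn_comp hvn)]. Qed.

Lemma Z_in_M : M Z.
Proof. by do ?[assumption | apply: (vn_comp hvn)]. Qed.

Lemma X_contraction : positive_contraction ip X.
Proof.
have lPc := linear_compl lP; have sPc := selfadjoint_compl (proj_sa hP).
split; first by do 2 apply: linear_comp_op => //.
  by move=> x y; rewrite /X /= sQc sPc sQc.
move=> x; rewrite /X /= (adjoint_rip _ _ sQc).
have -> : rip (compl P (Qc x)) (Qc x) = nsq (compl P (Qc x)).
  by rewrite -{1}(compl_proj_idem _ hP) (adjoint_rip _ _ sPc).
rewrite nsq_ge0 /=; apply: (le_trans (compl_proj_le (Qc x) hP)).
exact: compl_proj_le.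
Qed.

Lemma Z_selfadjoint : selfadjoint ip Z.
Proof. by move=> x y; rewrite /Z /= !(proj_sa hP) (proj_sa hQ) !(proj_sa hP). Qed.

Let lX : linear X. Proof. by case: X_contraction. Qed.
Let lZ : linear Z. Proof. by do 2 apply: linear_comp_op => //. Qed.

Lemma X_Qc x : X (Qc x) = X x.
Proof. by rewrite /X /= Qc_idem. Qed.

Lemma iterX_Qc k x : iter k.+1 X (Qc x) = iter k.+1 X x.
Proof. by rewrite !iterSr X_Qc. Qed.

Lemma Z_P x : Z (P x) = Z x.
Proof. by rewrite /Z /= (proj_idem hP). Qed.

Lemma P_Z x : P (Z x) = Z x.
Proof. by rewrite /Z /= (proj_idem hP). Qed.

Lemma iterZ_P k x : iter k Z (P x) = P (iter k Z x).
Proof. by apply: iter_commute => y; rewrite Z_P P_Z. Qed.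

Lemma ZP_selfadjoint k : selfadjoint ip (iter k Z \o P).
Proof.
by move=> x y; rewrite /= (selfadjoint_iter _ Z_selfadjoint) (proj_sa hP) iterZ_P.
Qed.

Lemma ZP_form_ge0 k x : 0 <= rip ((iter (k + k) Z \o P) x) x.
Proof.
rewrite [(_ \o _) x]/= iterZ_P (rip_proj_l hP) -iterZ_P.
by rewrite (rip_iter2 _ _ Z_selfadjoint) nsq_ge0.
Qed.

(** [Q^c P] intertwines the compressions [Q^c P^c Q^c] and [P Q P]. *)
Lemma X_intertwine k x : iter k X (Qc (P x)) = Qc (P (iter k Z x)).
Proof.
elim: k x => // k IH x; rewrite !iterSr -IH; congr (iter k X _).
rewrite X_Qc /X /= {1}/compl (linB lQc) Qc_idem -(linB lQc); congr (Qc _).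
by rewrite /Qc /Z /compl /= (linB lP) !(proj_idem hP) opprB addrC subrK.
Qed.

(** Both differences of consecutive powers have the trace of [P Q^c P (P Q P)^k],
    by the intertwining relation and the trace property. *)
Lemma tau_power_step k :
  tau (iter k X \o Qc) - tau (iter k.+1 X \o Qc)
  = tau (iter k Z \o P) - tau (iter k.+1 Z \o P).
Proof.
have MQc : M Qc := vn_compl hvn MQ.
have mc := vn_comp hvn; have mi := vn_iter hvn.
have MXk j : M (iter j X) := mi j _ X_in_M; have MZk j : M (iter j Z) := mi j _ Z_in_M.
rewrite -!tauB; try by apply: mc.
have -> : (fun x => (iter k X \o Qc) x - (iter k.+1 X \o Qc) x)
    = (Qc \o P) \o (iter k Z \o Qc).
  apply/funext => x /=; rewrite -X_intertwine -[X (iter k X _)]iterS iterSr.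
  rewrite -(linB (linear_iter k lX)) X_Qc; congr (iter k X _).
  rewrite /X /= {1}/compl (linB lQc) Qc_idem.
  by rewrite opprB addrC subrK.
have -> : (fun x => (iter k Z \o P) x - (iter k.+1 Z \o P) x)
    = (iter k Z \o P) \o (Qc \o P).
  apply/funext => x /=; rewrite -[Z (iter k Z _)]iterS iterSr.
  rewrite -(linB (linear_iter k lZ)) -[iter k Z (P (Qc _))]/(_); congr (iter k Z _).
  by rewrite /Z /Qc /= /compl (linB lP) !(proj_idem hP).
rewrite tau_cyc; try by do ?[assumption | apply: mc].
have -> : (iter k Z \o Qc) \o (Qc \o P) = (iter k Z \o Qc) \o P.
  by apply/funext => x /=; rewrite Qc_idem.
have -> : (iter k Z \o P) \o (Qc \o P) = (iter k Z \o (P \o Qc)) \o P by [].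
have M1 : M (iter k Z \o Qc) := mc _ _ (MZk k) MQc.
have M2 : M (iter k Z \o (P \o Qc)) := mc _ _ (MZk k) (mc _ _ MP MQc).
rewrite !(tau_cyc (B := P))//.
congr tau; apply/funext => x /=.
by rewrite -!iterZ_P (proj_idem hP).
Qed.

Lemma tau_powers k :
  tau Qc - tau (iter k X \o Qc) = tau P - tau (iter k Z \o P).
Proof.
elim: k => [|k IH]; first by rewrite !subrr.
by rewrite -[LHS](subrKA (tau (iter k X \o Qc))) IH tau_power_step subrKA.
Qed.

(** For [k >= 1], [Q^c - X^(2 k)] and [P - Z^(2 k)] have the same trace, and
    [Z^(2 k)] is positive. *)
Lemma rtau_powers_le k : rtau (compl (iter (k + k) X)) <= rtau P + rtau Q.
Proof.
have [_ P0] := tau_proj MP hP; have [_ Q0] := tau_proj MQ hQ.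
have mi := vn_iter hvn; have mc := vn_comp hvn.
case: k => [|k].
  rewrite (_ : compl _ = fun=> 0); first by rewrite /rtau tau0 addr_ge0.
  by apply/funext => x; rewrite /compl subrr.
have XE : iter (k.+1 + k.+1) X \o Qc = iter (k.+1 + k.+1) X.
  by apply/funext => x; exact: (iterX_Qc (k + k.+1)).
have := tau_powers (k.+1 + k.+1); rewrite XE => /(f_equal (@complex.Re R)).
rewrite !ReB -!/(rtau _) rtau_compl; last exact: mi X_in_M.
rewrite rtau_compl// => h.
suff : 0 <= rtau (iter (k.+1 + k.+1) Z \o P) by lra.
apply: (proj2 (tau_pos _ _ _)); first by apply: mc => //; exact: mi Z_in_M.
  exact: ZP_selfadjoint.
exact: ZP_form_ge0.
Qed.

(** [X] acts trivially from the left of [1 - S], which lies below [1 - P] and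
    [1 - Q]. *)
Lemma joinC_iterX x k : compl S (iter k X x) = compl S x.
Proof.
elim: k => // k IH; rewrite iterS -IH /X /=; set y := iter k X x.
have h A z : A = P \/ A = Q -> compl S (compl A z) = compl S z.
  move=> hA; have SA : S (A z) = A z.
    by case: hA => ->; [exact: (join_fixl hQ hS)|exact: (join_fixr hP hS)].
  by rewrite /compl (linB lS) SA opprB addrA subrK.
by rewrite !h; [| right | left | right].
Qed.

Lemma nsq_iterX x k : nsq (iter k X x) = nsq (compl S x) + nsq (S (iter k X x)).
Proof. by rewrite (nsq_proj_split hSp (iter k X x)) -(joinC_iterX x k) addrC. Qed.

Lemma small_decrease (u : nat -> R) (e : R) : (forall k, 0 <= u k) -> 0 < e ->
  exists k, u k - u k.+1 < e.
Proof.
move=> u0 e0; apply: contrapT => /forallNP h.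
have hn n : u 0%N - u n >= n%:R * e.
  elim: n => [|n IH]; first by rewrite mul0r subrr.
  by have /negP := h n; rewrite -leNgt -natr1 mulrDl mul1r; lra.
have [n hn'] : exists n, u 0%N / e < n%:R.
  by exists (Num.bound (u 0%N / e)); apply: archi_boundP; rewrite divr_ge0 ?u0// ltW.
by have := hn n; have := u0 n; move: hn'; rewrite ltr_pdivrMr//; lra.
Qed.

(** On [Q H] the positive powers of [X] vanish. On [P H] they are [Q^c Z^k], and the squared
    norm of [Q^c Z^k p] is at most the decrease of that of [Z^k p] from [k] to
    [k + 1]. *)
Lemma iterX_small x (e : R) : S x = x -> 0 < e ->
  exists k, nsq (iter k X x) < e.
Proof.
move=> Sx e0; have e4 : 0 < e / 4 by rewrite divr_gt0.
have [p [q xpq]] := join_dense hH hS Sx e4.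
have [k hk] := @small_decrease (fun k => nsq (iter k.+1 Z p)) _
  (fun k => nsq_ge0 _ _) e4.
exists k.+1; set y := P p + Q q.
have Xy : iter k.+1 X y = Qc (P (iter k.+1 Z p)).
  rewrite -X_intertwine iterX_Qc /y (linD (linear_iter _ lX)).
  rewrite -[iter k.+1 X (Q q)]iterX_Qc /Qc /compl (proj_idem hQ) subrr.
  by rewrite (lin0 (linear_iter _ lX)) addr0.
have h1 : nsq (iter k.+1 X y) < e / 4.
  apply: le_lt_trans hk; rewrite Xy iterS P_Z -iterS nsq_compl//.
  rewrite lerD2l lerN2 [iter k.+2 Z p]iterS {1}/Z /=.
  by rewrite P_Z -iterS; exact: nsq_proj_le.
have h2 : nsq (iter k.+1 X (x - y)) < e / 4.
  exact: le_lt_trans (pcontr_iter_le _ _ X_contraction) xpq.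
have := nsqD_le ip (iter k.+1 X (x - y)) (iter k.+1 X y).
by rewrite -(linD (linear_iter _ lX)) subrK; lra.
Qed.

(** The join is the least upper bound of the operators
    [1 - (Q^c P^c Q^c)^(2 k)], to which normality applies. *)
Lemma rtau_join_le : rtau S <= rtau P + rtau Q.
Proof.
have mi := vn_iter hvn.
pose D : set (H -> H) := range (fun k => compl (iter (k + k) X)).
have sX : selfadjoint ip X by case: X_contraction.
have sD k : selfadjoint ip (compl (iter (k + k) X)).
  exact/selfadjoint_compl/selfadjoint_iter.
have fD k x : rip (compl (iter (k + k) X) x) x = nsq x - nsq (iter k X x).
  by rewrite rip_compl rip_iter2.
have MD k : M (compl (iter (k + k) X)) by apply: (vn_compl hvn); exact: mi X_in_M.
have D_le k l : (k <= l)%N ->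
    le_op ip (compl (iter (k + k) X)) (compl (iter (l + l) X)).
  move=> kl; apply: positive_op_rip => [x y|x].
    by rewrite ipBl ipBr !sD.
  rewrite ripDl ripNl !fD -(subnK kl) iterD.
  by have := pcontr_iter_le (l - k) (iter k X x) X_contraction; lra.
have fS x : rip (S x) x = nsq x - nsq (compl S x).
  by rewrite (rip_proj hSp) nsq_compl// opprB addrC subrK.
have lubS : lub_in ip M D S.
  split=> // [_ [k _ <-]|C MC DC x].
    apply: positive_op_rip => [x y|x].
      by rewrite ipBl ipBr sD (proj_sa hSp).
    rewrite ripDl ripNl fD fS nsq_iterX.
    by have := nsq_ge0 ip (S (iter k X x)); lra.
  have C_real : ip (C x) x = (rip (C x) x)%:C.
    have := DC _ (ex_intro2 _ _ 0%N I erefl) x; rewrite /= ipBl => /ge0_ReK.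
    rewrite (selfadjoint_ip_real _ (sD 0%N)) ReB -/(rip _ _) /= => /eqP.
    by rewrite subr_eq -rmorphD subrK => /eqP.
  rewrite ipBl C_real (selfadjoint_ip_real _ (proj_sa hSp)) -rmorphB ler0c.
  rewrite subr_ge0 -subr_le0; apply: (@le0_of_small _ _ 1) => e e0.
  have [k hk] := iterX_small (proj_idem hSp x) e0.
  have Ck : rip (compl (iter (k + k) X) x) x <= rip (C x) x.
    by have := ge0_Re (DC _ (ex_intro2 _ _ k I erefl) x); rewrite ipBl ReB subr_ge0.
  move: Ck; rewrite fD fS nsq_iterX.
  suff -> : S (iter k X x) = iter k X (S x) by lra.
  have lXk := linear_iter k lX.
  have Xc : iter k X (compl S x) = compl S x.
    have Scx A : A = P \/ A = Q -> compl A (compl S x) = compl S x.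
      move=> hA; rewrite /compl; have -> : A (x - S x) = 0.
        case: hA => ->.
          by rewrite (linB lP) (join_absorbl hP hQ hS) subrr.
        by rewrite (linB lQ) (join_absorbr hP hQ hS) subrr.
      by rewrite subr0.
    elim: k {hk lXk} => // k IH; rewrite iterS IH /X /= /Qc.
    by rewrite !Scx; [| right | left | right].
  have -> : S (iter k X x) = iter k X x - compl S x.
    by rewrite -(joinC_iterX x k) /compl opprB addrC subrK.
  by rewrite -Xc -(linB lXk) /compl opprB addrC subrK.
case: (hM) => _ [_ _ _ /(_ D S)]; rewrite -/(rtau S) => -> //; last first.
- move=> _ _ [k _ <-] [l _ <-]; exists (compl (iter (maxn k l + maxn k l) X)).
  split; first by exists (maxn k l).
    by apply: D_le; exact: leq_maxl.
  by apply: D_le; exact: leq_maxr.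
- move=> _ [k _ <-]; split=> //; apply: positive_op_rip => // x.
  by rewrite fD subr_ge0 pcontr_iter_le//; exact: X_contraction.
- by exists (compl (iter (0 + 0) X)); exists 0%N.
apply: ge_sup.
  exists (rtau (compl (iter (0 + 0) X))), (compl (iter (0 + 0) X)) => //.
  by exists 0%N.
by move=> _ [_ [k _ <-] <-]; exact: rtau_powers_le.
Qed.

End Subadditivity.
End Trace.
(** * Freeness of the spectral projections *)

Section Words.
Context (R : realType) (H : completeNormedModType R[i]).

Definition opprod (s : seq (H -> H)) : H -> H :=
  foldr (fun S T => S \o T) idfun s.

Lemma opprod_cat s t : opprod (s ++ t) = opprod s \o opprod t.
Proof. by elim: s => //= S s ->. Qed.

Lemma opprod_bigE (s : seq (nat * (H -> H))) d :
  \big[(fun S T => S \o T)/idfun]_(j < size s) (nth d s j).2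
  = opprod [seq u.2 | u <- s].
Proof.
rewrite -(big_mkord xpredT (fun j => (nth d s j).2)) -(big_nth d xpredT).
by elim: s => [|u s IH]; [rewrite big_nil|rewrite big_cons IH].
Qed.

(** Letters are operators labelled by the subalgebra they come from. *)
Fixpoint letters_in (L : nat -> set (H -> H)) (s : seq (nat * (H -> H))) : Prop :=
  if s is u :: s' then L u.1 u.2 /\ letters_in L s' else True.

Lemma letters_in_nth L s d j : letters_in L s -> (j < size s)%N ->
  L (nth d s j).1 (nth d s j).2.
Proof. by elim: s j => // u s IH [|j] /= [hu hs] js; [|exact: IH]. Qed.

Lemma letters_in_rcons L s u :
  letters_in L (rcons s u) -> letters_in L s /\ L u.1 u.2.
Proof. by elim: s => [|v s IH] /=; [case|move=> [hv /IH[]]]. Qed.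

Definition alternating (w : seq nat) : bool := sorted (fun i j => i != j) w.

End Words.

Section Freeness.
Context (R : realType) (H : completeNormedModType R[i]).
Context (ip : {dot H for Num.conj}) (hH : hilbert_norm ip).
Context (M : set (H -> H)) (tau : (H -> H) -> R[i]).
Hypothesis hM : tracial_Wstar_probability_space ip M tau.
Context (U : nat -> H -> H) (E : nat -> set R -> H -> H).
Hypotheses (MU : forall n, M (U n)) (sU : forall n, selfadjoint ip (U n)).
Hypothesis hE : forall n, is_spectral_measure ip (U n) (E n).
Hypothesis hfree : freely_independent tau U.
Implicit Types (A B C D S T : H -> H) (n i : nat).

Local Notation rip := (rip ip).
Local Notation nsq := (nsq ip).
Local Notation rtau := (rtau tau).
Let hvn := trace_vn hM.

Lemma M_spec_gt n (a : R) : M (E n `]a, +oo[%classic).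
Proof. exact: (vn_spec hH hvn a (MU n) (sU n) (hE n)). Qed.

Lemma spec_gt_proj n (a : R) : orth_proj ip (E n `]a, +oo[%classic).
Proof. by apply: (spec_proj (hE n)); exact: measurable_itv. Qed.

Lemma spec_le_compl n (a : R) :
  E n `]-oo, a]%classic = compl (E n `]a, +oo[%classic).
Proof. by apply/funext => x; rewrite (spec_le_gt (hE n)). Qed.

Lemma M_spec_le n (a : R) : M (E n `]-oo, a]%classic).
Proof. by rewrite spec_le_compl; apply: (vn_compl hvn); exact: M_spec_gt. Qed.

Lemma spec_le_proj n (a : R) : orth_proj ip (E n `]-oo, a]%classic).
Proof. by apply: (spec_proj (hE n)); exact: measurable_itv. Qed.

Definition has_adjoint_in S : Prop :=
  M S /\ exists2 S', M S' & adjoint_of ip S S'.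

Lemma has_adjoint_sa S : M S -> selfadjoint ip S -> has_adjoint_in S.
Proof. by move=> MS sS; split=> //; exists S. Qed.

Lemma has_adjoint_comp S T : has_adjoint_in S -> has_adjoint_in T ->
  has_adjoint_in (S \o T).
Proof.
move=> [MS [S' MS' hS]] [MT [T' MT' hT]]; split; first exact: (vn_comp hvn).
by exists (T' \o S'); [exact: (vn_comp hvn)|exact: adjoint_comp].
Qed.

Lemma has_adjoint_comb c S T : has_adjoint_in S -> has_adjoint_in T ->
  has_adjoint_in (fun x => c *: S x + T x).
Proof.
move=> [MS [S' MS' hS]] [MT [T' MT' hT]]; split; first exact: (vn_comb hvn).
exists (fun x => Num.conj c *: S' x + T' x); first exact: (vn_comb hvn).
exact: adjoint_comb.
Qed.

Lemma has_adjoint_id : has_adjoint_in idfun.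
Proof. by apply: has_adjoint_sa; first exact: (vn_id hvn). Qed.

Lemma alg_has_adjoint n S : generated_algebra (U n) S -> has_adjoint_in S.
Proof.
apply; split; last by move=> _ ->; exact: has_adjoint_sa.
split; [exact: has_adjoint_id|exact: has_adjoint_comb|exact: has_adjoint_comp].
Qed.

Context (t : R).
Hypothesis no_atom : forall n (e : R), 0 < e -> exists2 d : R, 0 < d &
  rtau (E n `]t - d, +oo[%classic) - rtau (E n `]t + d, +oo[%classic) <= e.

Local Notation P n := (E n `]-oo, t]%classic).

(** Below [t - d] and above [t + d] the cut-off is close to the spectral
    projection; the part in between has small trace. *)
Lemma spec_le_l2_approx n (e : R) : 0 < e -> exists h,
  [/\ generated_algebra (U n) h, selfadjoint ip h &
      rtau ((fun x => P n x - h x) \o (fun x => P n x - h x)) <= e].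
Proof.
move=> e0; have e32 : 0 < e / 32 by rewrite divr_gt0.
have [d d0 hd] := no_atom n e32.
have bU := vn_bounded hvn (MU n).
have [h [hU hh hlow hhigh]] := spectral_cutoff hH (hE n) bU (sU n) t d0 e32.
have sh : selfadjoint ip h by case: hh.
have lh : linear h by case: hh.
exists h; split=> //; have [Mh _] := alg_has_adjoint hU.
have MP := M_spec_le n t; have hP := spec_le_proj n t; have lP := proj_linear hP.
set D := fun x => P n x - h x.
have MD : M D by exact: (vn_sub hvn).
have sD : selfadjoint ip D.
  by move=> x y; rewrite /D ipBl ipBr (proj_sa hP) sh.
have lD := vn_lin hvn MD.
set Ea := E n `]t - d, +oo[%classic; set Eb := E n `]t + d, +oo[%classic.
have Ma : M Ea := M_spec_gt n _; have Mb : M Eb := M_spec_gt n _.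
have hEa : orth_proj ip Ea := spec_gt_proj n _.
have hEb : orth_proj ip Eb := spec_gt_proj n _.
pose F x : H := Ea x - Eb x.
have MF : M F by exact: (vn_sub hvn).
have FE x : F x = E n `]t - d, t + d]%classic x.
  by rewrite (spec_itv (hE n))//; lra.
have hF : orth_proj ip F.
  rewrite (_ : F = E n `]t - d, t + d]%classic); last by apply/funext.
  by apply: (spec_proj (hE n)); exact: measurable_itv.
pose B x : H := (e / 4)%:C *: idfun x + (fun x => 16%:C *: F x) x.
have M16 : M (fun x => 16%:C *: F x) by exact: (vn_scale hvn).
have MB : M B by apply: (vn_comb hvn) => //; exact: (vn_id hvn).
have tauBE : rtau B = e / 4 + 16 * rtau F.
  have Mid := vn_id hvn.
  by rewrite /B (rtau_comb hM)// (rtauZ hM)// (rtau_id hM) mulr1.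
apply: (@le_trans _ _ (rtau B)); last first.
  by rewrite tauBE /F (rtauB hM)//; move: hd; rewrite -/Ea -/Eb; lra.
apply: (rtau_le hM) => //.
- exact: (vn_comp hvn).
- by move=> x y /=; rewrite !sD.
- move=> x y; rewrite /B ipDl ipDr !ipZl !ipZr !conj_realC.
  by rewrite (proj_sa hF).
move=> x; rewrite /= (adjoint_rip _ _ sD) -/(nsq _).
rewrite /B ripDl !ripZl (rip_proj hF) -/(nsq x).
set x1 := E n `]-oo, (t - d)]%classic x.
have hx1 : orth_proj ip (E n `]-oo, (t - d)]%classic) := spec_le_proj n _.
have xE : x = x1 + (F x + Eb x).
  by rewrite /x1 spec_le_compl /compl /F !subrK.
have h1 : nsq (D x1) <= e / 32 * nsq x.
  have -> : D x1 = x1 - h x1.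
    rewrite /D (spec_sub (hE n))// => y /=; rewrite !in_itv /= => /le_trans; apply.
    by rewrite gerBl ltW.
  apply: (le_trans (hlow _ (proj_idem hx1 x))); rewrite ler_pM2l//.
  exact: nsq_proj_le.
have h3 : nsq (D (Eb x)) <= e / 32 * nsq x.
  have -> : D (Eb x) = - h (Eb x).
    rewrite /D (spec_disjoint (hE n)) ?sub0r//.
    apply/seteqP; split=> // y /= []; rewrite !in_itv /= andbT => yt /lt_le_trans/(_ yt).
    by rewrite gtrDl ltNge (ltW d0).
  rewrite nsqN; apply: (le_trans (hhigh _ (proj_idem hEb x))); rewrite ler_pM2l//.
  exact: nsq_proj_le.
have h2 : nsq (D (F x)) <= 4 * nsq (F x).
  have := nsqD_le ip (P n (F x)) (- h (F x)); rewrite nsqN.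
  have := nsq_proj_le hP (F x); have := pcontr_le (F x) hh; rewrite /D; lra.
rewrite [in leLHS]xE (linD lD) [D (F x + _)](linD lD).
have := nsqD_le ip (D x1) (D (F x) + D (Eb x)).
have := nsqD_le ip (D (F x)) (D (Eb x)).
have := mulr_ge0 (ltW e0) (nsq_ge0 ip x); lra.
Qed.

Definition centered n : H -> H := fun x => P n x - tau (P n) *: x.

Lemma M_centered n : M (centered n).
Proof.
apply: (vn_sub hvn); first exact: M_spec_le.
by apply: (vn_scale hvn); exact: (vn_id hvn).
Qed.

Lemma sa_centered n : selfadjoint ip (centered n).
Proof.
have hP := spec_le_proj n t; have [tP _] := tau_proj hM (M_spec_le n t) hP.
by move=> x y; rewrite /centered tP ipBl ipBr ipZl ipZr conj_realC (proj_sa hP).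
Qed.

(** [tau (A y B)] is continuous in [y] for the 2-norm, so that the vanishing for
    centered elements of the algebra passes to the centered projection. *)
Lemma centered_limit n A B : has_adjoint_in A -> has_adjoint_in B ->
  (forall y, generated_algebra (U n) y -> tau y = 0 -> tau (A \o y \o B) = 0) ->
  tau (A \o centered n \o B) = 0.
Proof.
move=> adA adB hy; have adC := has_adjoint_comp adB adA.
have MA : M A by case: adA. have MB : M B by case: adB.
set C := B \o A in adC; have MC : M C by case: adC.
have lC := vn_lin hvn MC; have MP := M_spec_le n t; have Mid := vn_id hvn.
have mc := vn_comp hvn.
have cycC y : M y -> tau (A \o y \o B) = tau (C \o y).
  by move=> My; rewrite (tau_cyc hM)//; exact: mc.
pose C0 : H -> H := fun x => (- tau C) *: idfun x + C x.
have [MC0 [C0' MC0' adC0]] : has_adjoint_in C0.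
  by apply: has_adjoint_comb => //; exact: has_adjoint_id.
have tauC y c : M y -> tau (C \o (fun x => y x - c *: x)) = tau (C \o y) - c * tau C.
  move=> My; have McC : M (fun x => c *: C x) by exact: (vn_scale hvn).
  rewrite -(tauZ hM)// -(tauB hM)//; last exact: mc.
  by congr tau; apply/funext => x /=; rewrite (linB lC) (linZ _ _ lC).
rewrite cycC; last exact: M_centered.
have key e : 0 < e ->
    complex.Re (tau (C \o centered n)) ^+ 2 + complex.Im (tau (C \o centered n)) ^+ 2
      <= e * (rtau (C0 \o C0') + 1).
  move=> e0; have [h [hU sh he]] := spec_le_l2_approx n e0.
  have [Mh _] := alg_has_adjoint hU.
  pose D : H -> H := fun x => P n x - h x.
  have MD : M D by exact: (vn_sub hvn).
  have sD : selfadjoint ip D.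
    by move=> x y; rewrite /D ipBl ipBr (proj_sa (spec_le_proj n t)) sh.
  have Ch : tau (C \o h) = tau h * tau C.
    have My : M (fun x => h x - tau h *: x).
      by apply: (vn_sub hvn) => //; exact: (vn_scale hvn).
    apply/eqP; rewrite -subr_eq0 -tauC// -cycC//; apply/eqP/hy.
      rewrite (_ : (fun x => _) = fun x => (- tau h) *: idfun x + h x).
        exact: (alg_comb _ (@alg_id _ _ (U n)) hU).
      by apply/funext => x; rewrite scaleNr addrC.
    have Mc : M (fun x => tau h *: idfun x) by exact: (vn_scale hvn).
    by rewrite (tauB hM)// (tauZ hM)// (tau_id hM) mulr1 subrr.
  have -> : tau (C \o centered n) = tau (C0 \o D).
    rewrite /centered tauC//.
    have -> : C0 \o D = fun x => (- tau C) *: D x + (C \o D) x by [].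
    rewrite (tau_comb hM)//; last exact: mc.
    have -> : C \o D = fun x => (C \o P n) x - (C \o h) x.
      by apply/funext => x /=; rewrite /D (linB lC).
    by rewrite !(tauB hM)//; [rewrite Ch; ring|exact: mc|exact: mc].
  have := tau_cauchy_schwarz hM MC0 MC0' MD adC0 sD.
  move=> /le_trans; apply; rewrite mulrC ler_wpM2r//.
  rewrite addr_ge0//; apply: (proj2 (tau_pos hM _ _ _)); first exact: mc.
    by move=> x y /=; rewrite adC0 (adjointC adC0).
  by move=> x /=; rewrite (adjoint_rip _ _ adC0) nsq_ge0.
have := le0_of_small key.
case: (tau _) => a b /= ab0.
have a0 : 0 <= a ^+ 2 by exact: sqr_ge0.
have b0 : 0 <= b ^+ 2 by exact: sqr_ge0.
have /eqP : a ^+ 2 = 0 by lra.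
have /eqP : b ^+ 2 = 0 by lra.
by rewrite !sqrf_eq0 => /eqP -> /eqP ->.
Qed.

Let alg_letter n S : Prop := generated_algebra (U n) S /\ tau S = 0.
Let letter n S : Prop := alg_letter n S \/ S = centered n.

Lemma letter_has_adjoint n S : letter n S -> has_adjoint_in S.
Proof.
move=> [[+ _]| ->]; first exact: alg_has_adjoint.
by apply: has_adjoint_sa; [exact: M_centered|exact: sa_centered].
Qed.

Lemma word_has_adjoint s : letters_in letter s ->
  has_adjoint_in (opprod [seq u.2 | u <- s]).
Proof.
elim: s => [_|u s IH /= [hu hs]]; first exact: has_adjoint_id.
by apply: has_adjoint_comp; [exact: letter_has_adjoint hu|exact: IH].
Qed.

Lemma letters_in_alg s : letters_in alg_letter s -> letters_in letter s.
Proof. by elim: s => //= u s IH [hu hs]; split; [left|exact: IH]. Qed.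

Lemma free_alg_word u : (0 < size u)%N -> alternating [seq v.1 | v <- u] ->
  letters_in alg_letter u -> tau (opprod [seq v.2 | v <- u]) = 0.
Proof.
move=> u0 alt hu; pose d : nat * (H -> H) := (0%N, idfun).
rewrite -(opprod_bigE u d).
apply: (hfree (i := fun j => (nth d u j).1) (a := fun j => (nth d u j).2)).
- exact: u0.
- by move=> j ju; exact: (letters_in_nth d hu).
- move=> j ju; move: alt; rewrite /alternating => /(sortedP 0%N) /(_ j).
  by rewrite size_map !(nth_map d)// ?(ltnW ju)// => /(_ ju)/eqP.
Qed.

(** The letters of [s1] may be centered projections. They are treated one at a time
    from the right end of [s1]: by [centered_limit], a centered projection may be
    replaced by an arbitrary centered element of its algebra. *)
Lemma free_word s1 s2 :
  alternating [seq v.1 | v <- s1 ++ s2] -> (0 < size (s1 ++ s2))%N ->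
  letters_in letter s1 -> letters_in alg_letter s2 ->
  tau (opprod [seq v.2 | v <- s1 ++ s2]) = 0.
Proof.
elim/last_ind: s1 s2 => [|s1 [i S] IH] s2 alt s0 h1 h2.
  exact: free_alg_word.
have [hs1 /= hS] := letters_in_rcons h1.
rewrite cat_rcons in alt s0 *.
case: hS => [hS|->]; first by apply: IH.
rewrite map_cat opprod_cat [opprod (map _ (_ :: _))]/=.
have lim := @centered_limit i (opprod [seq v.2 | v <- s1]) (opprod [seq v.2 | v <- s2]).
apply: lim; [exact: word_has_adjoint|exact/word_has_adjoint/letters_in_alg|].
move=> y hy y0; have := IH ((i, y) :: s2).
rewrite !map_cat opprod_cat /=; apply => //.
- by move: alt; rewrite !map_cat.
- by rewrite size_cat addnS.
Qed.

Lemma free_centered w : (0 < size w)%N -> alternating w ->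
  tau (opprod [seq centered i | i <- w]) = 0.
Proof.
move=> w0 alt; have := @free_word [seq (i, centered i) | i <- w] [::].
rewrite cats0 -!map_comp map_id_in//; apply => //; first by rewrite size_map.
by elim: w {w0 alt} => //= i w IH; split=> //; right.
Qed.

End Freeness.
(** * The infimum of free projections: upper bound by Bessel's inequality *)

Section AlternatingWords.
Variable m : nat.

(** Alternating words over the letters below [m], of length at most [K], not
    starting with the letter [i]; for [i = m] this last condition is void. *)
Fixpoint words (K i : nat) : seq (seq nat) :=
  if K is K'.+1 then
    [::] :: [seq j :: w | j <- [seq j <- iota 0 m | j != i], w <- words K' j]
  else [:: [::]].

Lemma mem_words K i w : w \in words K i ->
  path (fun a b => a != b) i w && all (fun j => (j < m)%N) w.
Proof.
elim: K i w => [|K IH] i w /=; first by rewrite inE => /eqP ->.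
rewrite inE => /orP[/eqP -> //|/allpairsPdep[j [v [+ /IH/andP[jv vm] ->]]]].
by rewrite mem_filter mem_iota add0n /= eq_sym jv vm !andbT.
Qed.

Lemma uniq_words K i : uniq (words K i).
Proof.
elim: K i => //= K IH i; apply/andP; split.
  by apply/negP => /allpairsPdep[j [v []]].
apply: allpairs_uniq_dep => //; first by rewrite filter_uniq// iota_uniq.
by move=> [j v] [j' v'] _ _ /= [-> ->].
Qed.

Lemma alternating_words K i w : w \in words K i -> alternating w.
Proof. by move=> /mem_words/andP[/path_sorted]. Qed.

Section GeneratingSum.
Context (R : realType) (r : R).

Definition word_sum K i : R := \sum_(w <- words K i) r ^+ size w.

Lemma word_sumS K i : word_sum K.+1 i
  = 1 + \sum_(j <- iota 0 m | j != i) r * word_sum K j.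
Proof.
rewrite /word_sum big_cons /= expr0 big_allpairs_dep big_filter; congr (_ + _).
by apply: eq_bigr => j _; rewrite big_distrr; apply: eq_bigr => w _; rewrite exprS.
Qed.

Fixpoint geom_sum (y : R) K : R := if K is K'.+1 then 1 + y * geom_sum y K' else 1.

Lemma word_sum_letter K i : (i < m)%N ->
  word_sum K i = geom_sum (m.-1%:R * r) K.
Proof.
elim: K i => [|K IH] i im; first by rewrite /word_sum /= big_seq1 expr0.
rewrite word_sumS /= big_seq_cond.
rewrite (eq_bigr (fun=> r * geom_sum (m.-1%:R * r) K)); last first.
  by move=> j /andP[+ _]; rewrite mem_iota /= add0n => jm; rewrite IH.
rewrite -big_seq_cond big_const_seq iter_addr_0.
have -> : count (fun j => j != i) (iota 0 m) = m.-1.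
  have := count_predC (pred1 i) (iota 0 m); rewrite size_iota.
  have -> : count (pred1 i) (iota 0 m) = 1%N.
    by have := count_uniq_mem i (iota_uniq 0 m); rewrite mem_iota add0n im.
  by rewrite add1n => h; rewrite -[in RHS]h.
by rewrite -(mulr_natl (r * geom_sum (m.-1%:R * r) K)) mulrA.
Qed.

Lemma word_sum_root K : word_sum K.+1 m
  = 1 + m%:R * r * geom_sum (m.-1%:R * r) K.
Proof.
rewrite word_sumS big_seq_cond.
rewrite (eq_bigr (fun=> r * geom_sum (m.-1%:R * r) K)); last first.
  by move=> j /andP[+ _]; rewrite mem_iota /= add0n => jm; rewrite word_sum_letter.
rewrite -big_seq_cond big_const_seq iter_addr_0.
have -> : count (fun j => j != m) (iota 0 m) = m.
  rewrite -[RHS](size_iota 0 m) -count_predT; apply: eq_in_count => j.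
  by rewrite mem_iota /= add0n => jm; rewrite neq_ltn jm.
by rewrite -(mulr_natl (r * geom_sum (m.-1%:R * r) K)) mulrA.
Qed.

Lemma geom_sum_ge y K : 1 <= y -> K.+1%:R <= geom_sum y K.
Proof.
move=> y1; elim: K => //= K IH; rewrite -natr1 addrC lerD2l.
by rewrite -[leLHS]mul1r ler_pM.
Qed.

Lemma geom_sumE y K : (1 - y) * geom_sum y K = 1 - y ^+ K.+1.
Proof.
elim: K => [|K IH] /=; first by rewrite mulr1.
by rewrite mulrDr mulr1 mulrCA IH !exprS; ring.
Qed.

End GeneratingSum.
End AlternatingWords.

Section UpperBound.
Context (R : realType) (H : completeNormedModType R[i]).
Context (ip : {dot H for Num.conj}) (hH : hilbert_norm ip).
Context (M : set (H -> H)) (tau : (H -> H) -> R[i]).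
Hypothesis hM : tracial_Wstar_probability_space ip M tau.
Context (p : nat -> H -> H) (s : R) (e : H -> H) (m : nat).
Hypotheses (Mp : forall i, M (p i)) (sp : forall i, selfadjoint ip (p i)).
Hypothesis p_sqr : forall i x,
  p i (p i x) = (1 - 2 * s)%:C *: p i x + (s * (1 - s))%:C *: x.
Hypothesis p_free : forall w, (0 < size w)%N -> alternating w ->
  tau (opprod [seq p i | i <- w]) = 0.
Hypotheses (he : orth_proj ip e) (Me : M e).
Hypothesis ep : forall i x, (i < m)%N -> e (p i x) = (1 - s)%:C *: e x.
Hypotheses (s0 : 0 < s) (s1 : s <= 1) (m0 : (0 < m)%N).

Local Notation rip := (rip ip).
Local Notation nsq := (nsq ip).
Local Notation rtau := (rtau tau).
Local Notation q := (1 - s).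
Local Notation r := (q / s).
Let hvn := trace_vn hM.

Definition word w : H -> H := opprod [seq p i | i <- w].

Lemma word_cat u w : word (u ++ w) = word u \o word w.
Proof. by rewrite /word map_cat opprod_cat. Qed.

Lemma word_cons i w : word (i :: w) = p i \o word w. Proof. by []. Qed.

Lemma M_word w : M (word w).
Proof.
by elim: w => [|i w IH]; [exact: (vn_id hvn)|exact: (vn_comp hvn (Mp i) IH)].
Qed.

Lemma adjoint_word w : adjoint_of ip (word w) (word (rev w)).
Proof.
elim: w => [//|i w IH]; rewrite rev_cons -cats1 word_cat.
exact: adjoint_comp (@sp i) IH.
Qed.

Lemma rtau_word w : (0 < size w)%N -> alternating w -> rtau (word w) = 0.
Proof. by move=> w0 alt; rewrite -[rtau _]/(complex.Re (tau _)) p_free. Qed.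

Lemma alternating_meet u i w : alternating (i :: u) ->
  path (fun a b => a != b) i w -> alternating (rev u ++ i :: w).
Proof.
move=> iu iw; rewrite /alternating sorted_cat_cons iw andbT -rev_cons.
rewrite rev_sorted; move: iu; rewrite /alternating /=.
by under eq_path do rewrite eq_sym.
Qed.

(** When two equal letters meet, [p i ^ 2 = (1 - 2 s) p i + s q] leaves an
    alternating word, of trace zero, and a shorter product of the same kind. *)
Lemma word_orthogonal u w : alternating u -> alternating w ->
  rtau (word (rev u) \o word w) = if u == w then (s * q) ^+ size u else 0.
Proof.
elim: u w => [|i u IH] w au aw.
  case: w aw => [|j w] aw; first by rewrite expr0 (rtau_id hM).
  by rewrite -word_cat rtau_word.
case: w aw => [|j w] aw.
  rewrite -word_cat cats0 rtau_word ?size_rev//.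
  by have := @alternating_meet u i [::] au isT; rewrite cats1 -rev_cons.
have au' : alternating u by move: au; exact: path_sorted.
have aw' : alternating w by move: aw; exact: path_sorted.
rewrite rev_cons -cats1 eqseq_cons; have [ij|ij] := eqVneq i j; last first.
  rewrite -word_cat -catA rtau_word// ?size_cat ?addnS//.
  by apply: alternating_meet => //; rewrite /= ij.
rewrite -ij {j ij} in aw *.
have MA := M_word (rev u); have MB := M_word w; have mc := vn_comp hvn.
have lA := vn_lin hvn MA.
have -> : word (rev u ++ [:: i]) \o word (i :: w) = fun x =>
    (1 - 2 * s)%:C *: (word (rev u ++ i :: w)) x
    + (fun x => (s * q)%:C *: (word (rev u) \o word w) x) x.
  apply/funext => x; rewrite !word_cat /= -!/(word (_ :: _)) !word_cons /=.
  by rewrite p_sqr (linD lA) !(linZ _ _ lA).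
rewrite (rtau_comb hM); [|exact: M_word|by apply: (vn_scale hvn); exact: mc].
rewrite (rtauZ hM); last exact: mc.
rewrite rtau_word ?size_cat ?addnS//; last exact: alternating_meet.
rewrite mulr0 add0r IH//=; case: ifP => _; last by rewrite mulr0.
by rewrite exprS.
Qed.

Lemma e_word w x : all (fun j => (j < m)%N) w ->
  e (word w x) = (q ^+ size w)%:C *: e x.
Proof.
elim: w => [_|i w IH /= /andP[im wm]]; first by rewrite expr0 scale1r.
by rewrite ep// IH// scalerA -rmorphM exprS.
Qed.

Lemma rtau_sum (W : seq (seq nat)) (c : seq nat -> R) (A : seq nat -> H -> H) :
  (forall w, M (A w)) ->
  M (fun x => \sum_(w <- W) (c w)%:C *: A w x) /\
  rtau (fun x => \sum_(w <- W) (c w)%:C *: A w x) = \sum_(w <- W) c w * rtau (A w).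
Proof.
move=> MA; elim: W => [|w W [IHM IH]].
  rewrite big_nil (_ : (fun x => _) = fun=> 0); last first.
    by apply/funext => x; rewrite big_nil.
  by split; [exact: (vn_zero hvn)|rewrite (rtau0 hM)].
rewrite (_ : (fun x => _) = fun x => (c w)%:C *: A w x
    + (fun x => \sum_(w <- W) (c w)%:C *: A w x) x); last first.
  by apply/funext => x; rewrite big_cons.
split; first exact: (vn_comb hvn).
by rewrite (rtau_comb hM)// IH big_cons.
Qed.

(** Bessel's inequality for [e] and the orthogonal family of alternating words:
    the coefficient of [e] along [w] is [q ^ |w|] times its trace, and the squared
    norm of [w] is [(s q) ^ |w|]. *)
Lemma bessel_words K : rtau e * word_sum m r K m <= 1.
Proof.
pose W := words m K m; pose S := word_sum m r K m.
pose c (w : seq nat) : R := s ^- size w.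
have c_q w : c w * q ^+ size w = r ^+ size w.
  by rewrite /c exprMn exprVn mulrC.
have S_ge1 : 1 <= S.
  have r0 : 0 <= r by rewrite divr_ge0 ?subr_ge0// ltW.
  rewrite /S /word_sum; case: K {W S} => [|K] /=.
    by rewrite big_seq1 expr0.
  by rewrite big_cons expr0 lerDl sumr_ge0// => w _; rewrite exprn_ge0.
(* [f] is the optimal combination of words, [S] being both its squared norm and the
   eigenvalue of [e f]; the inequality is the positivity of the trace on
   [(f - S e)^* (f - S e)]. *)
pose f x : H := \sum_(w <- W) (c w)%:C *: word w x.
pose f' x : H := \sum_(w <- W) (c w)%:C *: word (rev w) x.
have [Mf _] := rtau_sum W c M_word.
have [Mf' _] := rtau_sum W c (fun w => M_word (rev w)).
pose g x : H := f x - S%:C *: e x; pose g' x : H := f' x - S%:C *: e x.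
have MSe : M (fun x => S%:C *: e x) by exact: (vn_scale hvn).
have Mg : M g by exact: (vn_sub hvn). have Mg' : M g' by exact: (vn_sub hvn).
have lg := vn_lin hvn Mg; have le := proj_linear he; have mc := vn_comp hvn.
have gg' : adjoint_of ip g' g.
  move=> x y; rewrite /g /g' ipBl ipBr ipZl ipZr conj_realC (proj_sa he).
  congr (_ - _); rewrite /f /f'.
  elim: W {f f' Mf Mf' g g' Mg Mg' lg} => [|w W IH].
    by rewrite !big_nil ip0l ip0r.
  rewrite !big_cons ipDl ipDr ipZl ipZr conj_realC IH; congr (_ * _ + _).
  by rewrite (adjointC (adjoint_word w)).
have g_pos : 0 <= rtau (g' \o g).
  apply: (proj2 (tau_pos hM _ _ _)); first exact: mc.
    by move=> x y /=; rewrite gg' -(adjointC gg').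
  by move=> x /=; rewrite (adjoint_rip _ _ gg') nsq_ge0.
have tau_eg : rtau (e \o g) = 0.
  rewrite (_ : e \o g = fun x => (0 : R)%:C *: e x); last first.
    apply/funext => x; rewrite /g /= (linB le) (linZ _ _ le) (proj_idem he).
    suff -> : e (f x) = S%:C *: e x by rewrite subrr scale0r.
    rewrite /f /S /word_sum -/W [in LHS]big_seq [in RHS]big_seq.
    elim/big_rec2: _ => [|w a b wW ih]; first by rewrite (lin0 le) scale0r.
    rewrite (linD le) (linZ _ _ le) e_word; last by case/andP: (mem_words wW).
    by rewrite scalerA -rmorphM c_q ih rmorphD scalerDl.
  by rewrite (rtauZ hM)// mul0r.
have tau_wg u : u \in W -> rtau (word (rev u) \o g) = q ^+ size u * (1 - S * rtau e).
  move=> uW; have Mu := M_word (rev u); have lu := vn_lin hvn Mu.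
  have [au um] : alternating u /\ all (fun j => (j < m)%N) u.
    by split; [exact: alternating_words uW|case/andP: (mem_words uW)].
  have [Mwf wfE] := rtau_sum W c (fun w => mc _ _ Mu (M_word w)).
  rewrite (_ : word (rev u) \o g = fun x =>
      (fun x => \sum_(w <- W) (c w)%:C *: (word (rev u) \o word w) x) x
      - (fun x => S%:C *: (word (rev u) \o e) x) x); last first.
    apply/funext => x; rewrite /g /f /= (linB lu) (linZ _ _ lu); congr (_ - _).
    elim: (W) => [|w V IH]; first by rewrite !big_nil (lin0 lu).
    by rewrite !big_cons (linD lu) (linZ _ _ lu) IH.
  have Mue : M (word (rev u) \o e) by exact: mc.
  rewrite (rtauB hM)//; last exact: (vn_scale hvn).
  rewrite wfE (rtauZ hM)// [rtau (_ \o e)](_ : _ = q ^+ size u * rtau e); last first.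
    rewrite (rtau_cyc hM)// -size_rev -(rtauZ hM)//.
    by congr rtau; apply/funext => x; rewrite /= e_word// all_rev.
  rewrite (bigD1_seq u)//= ?uniq_words// word_orthogonal// eqxx.
  rewrite [X in _ + X - _]big1_seq ?addr0; last first.
    move=> w /andP[wu wW]; rewrite word_orthogonal ?(alternating_words wW)//.
    by rewrite eq_sym (negbTE wu) mulr0.
  by rewrite /c exprMn mulrA mulVf ?expf_neq0 ?gt_eqF// mul1r; ring.
have : rtau (g' \o g) = S * (1 - S * rtau e).
  have [Mh hE] := rtau_sum W c (fun w => mc _ _ (M_word (rev w)) Mg).
  rewrite (_ : g' \o g = fun x =>
      (fun x => \sum_(w <- W) (c w)%:C *: (word (rev w) \o g) x) x
      - (fun x => S%:C *: (e \o g) x) x); last by apply/funext.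
  have Meg : M (e \o g) by exact: mc.
  rewrite (rtauB hM)//; last exact: (vn_scale hvn).
  rewrite hE (rtauZ hM)// tau_eg mulr0 subr0 [in RHS]/S /word_sum -/W big_distrl.
  rewrite big_seq [RHS]big_seq; apply: eq_bigr => w wW.
  by rewrite tau_wg// mulrA c_q.
rewrite mulrC -/S; nra.
Qed.

(** Let [K] tend to infinity in [bessel_words]: the geometric series of ratio
    [y := (m - 1) q / s] diverges for [y >= 1], and otherwise has the sum that makes
    the bound [1 - m q]. *)
Lemma rtau_inf_le : rtau e <= Num.max 0 (1 - m%:R * q).
Proof.
have [_ te0] := tau_proj hM Me he; set te := rtau e in te0 *.
have q0 : 0 <= q by rewrite subr_ge0.
have r0 : 0 <= r by rewrite divr_ge0// ltW.
have bessel K : te * (1 + m%:R * r * geom_sum (m.-1%:R * r) K) <= 1.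
  by rewrite -word_sum_root; exact: bessel_words.
set y := m.-1%:R * r in bessel *.
have mE : m%:R = m.-1%:R + 1 :> R by rewrite natr1 prednK.
have [y1|y1] := leP 1 y; rewrite le_max.
- apply/orP; left; apply: (@le0_of_small _ _ 1) => d d0; rewrite mulr1 leNgt.
  apply/negP => dte.
  have mr1 : 1 <= m%:R * r by rewrite mE mulrDl mul1r (le_trans y1)// lerDl.
  have := bessel (Num.bound d^-1).
  have := @archi_boundP _ d^-1; rewrite invr_ge0 => /(_ (ltW d0)).
  have := geom_sum_ge (Num.bound d^-1) y1; rewrite -natr1.
  set N := (Num.bound _)%:R; set G := geom_sum _ _ => NG hN hb.
  have N1 : 1 < d * N by rewrite mulrC -ltr_pdivrMr// div1r.
  have N0 : 0 <= N by rewrite ler0n.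
  have : G <= m%:R * r * G by rewrite ler_peMl//; lra.
  move=> h; have : te * N <= te * (1 + m%:R * r * G) by apply: ler_wpM2l => //; lra.
  have : d * N <= te * N by rewrite ler_wpM2r// ltW.
  lra.
- apply/orP; right; rewrite -subr_le0.
  have y0 : 0 <= y by rewrite mulr_ge0.
  have h : te * (1 + r) - (1 - y) <= 0.
    apply: (@le0_of_small _ _ (te * (m%:R * r))) => d d0.
    have [|k hk] := @geometric_small _ y d _ d0; first by rewrite y0.
    have y1' : 0 < 1 - y by rewrite subr_gt0.
    have := ler_wpM2l (ltW y1') (bessel k); rewrite mulr1.
    rewrite (_ : (1 - y) * (te * _) = te * ((1 - y) + m%:R * r * ((1 - y) * geom_sum y k))); last by ring.
    rewrite geom_sumE => hb.
    have hy : y ^+ k.+1 <= d.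
      rewrite exprS (le_trans _ (ltW hk))// ler_piMl ?exprn_ge0//; exact: ltW.
    have : te * (m%:R * r) * y ^+ k.+1 <= te * (m%:R * r) * d.
      apply: ler_wpM2l; last exact: hy.
      by apply: mulr_ge0 => //; apply: mulr_ge0.
    move: hb; rewrite mE (_ : (m.-1%:R + 1) * r = y + r); last by rewrite /y; ring.
    nra.
  have := mulr_ge0_le0 (ltW s0) h.
  suff -> : s * (te * (1 + r) - (1 - y)) = te - (1 - m%:R * q) by [].
  by rewrite mE /y; field; rewrite gt_eqF.
Qed.

End UpperBound.
(** * The uniform law and the limit of roots *)

Section UniformLaw.
Context (R : realType).

Definition uniform_tail (a : R) : R :=
  if a < 0 then 1 else if a <= 1 then 1 - a else 0.

Lemma uniform_prob_gt (a : R) :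
  uniform_prob (@ltr01 R) `]a, +oo[%classic = (uniform_tail a)%:E.
Proof.
have mB : measurable (`]a, +oo[%classic : set R) by exact: measurable_itv.
transitivity (lebesgue_measure (`[0%R, 1%R]%classic `&` `]a, +oo[%classic : set R)).
  rewrite /uniform_prob -integral_indic//.
  apply: eq_integral => x _; rewrite /uniform_pdf indicE subr0 invr1.
  by rewrite mem_setE in_itv; case: ifP.
rewrite /uniform_tail; case: ltP => [a0|a0]; last case: leP => [a1|a1].
- rewrite setIidl; first by rewrite lebesgue_measure_itv /= lte_fin ltr01 sube0.
  by move=> x /=; rewrite !in_itv /= andbT => /andP[x0 _]; exact: lt_le_trans x0.
- rewrite (_ : _ `&` _ = `]a, 1]%classic); last first.
    apply/seteqP; split=> x /=; rewrite !in_itv /= andbT.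
      by move=> [/andP[_ ->] ->].
    by move=> /andP[ax ->]; rewrite ax (le_trans a0 (ltW ax)).
  rewrite lebesgue_measure_itv /= lte_fin -EFinB.
  by case: ltP => // a1'; congr EFin; lra.
- rewrite (_ : _ `&` _ = set0) ?measure0//.
  apply/seteqP; split=> // x /=; rewrite !in_itv /= andbT => -[/andP[_ x1] ax].
  by have := lt_le_trans ax x1; rewrite ltNge (ltW a1).
Qed.

Lemma uniform_tail_cont (t e : R) : 0 < e ->
  exists2 d : R, 0 < d & uniform_tail (t - d) - uniform_tail (t + d) <= e.
Proof.
move=> e0; exists (e / 2); first by rewrite divr_gt0.
rewrite /uniform_tail; case: (ltP (t - e / 2) 0) => ?;
  case: (ltP (t + e / 2) 0) => ?; case: (leP (t - e / 2) 1) => ?;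
  case: (leP (t + e / 2) 1) => ?; lra.
Qed.

End UniformLaw.

Section Limits.
Context (R : realType).

(** Both bounds come from [1 + y <= expR y], for [y := l / (n + 1)] and [- y]. *)
Lemma ln_root_bounds (l : R) n : l <= 0 ->
  l <= n.+1%:R * (expR (l / n.+1%:R) - 1) <= l + l ^+ 2 / n.+1%:R.
Proof.
move=> l0; have m0 : 0 < n.+1%:R :> R by [].
set y := l / n.+1%:R; have y0 : y <= 0 by rewrite pmulr_lle0// invr_gt0.
have ly : l = n.+1%:R * y by rewrite mulrC divfK ?gt_eqF.
apply/andP; split.
  by rewrite [leLHS]ly ler_pM2l//; have := expR_ge1Dx y; lra.
have e1 : expR y * (1 - y) <= 1.
  rewrite -[leRHS](@expRxMexpNx_1 _ y) ler_pM2l ?expR_gt0//.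
  exact: expR_ge1Dx.
have e0 := expR_gt0 y.
have -> : l + l ^+ 2 / n.+1%:R = n.+1%:R * (y + y ^+ 2).
  by rewrite ly; field; rewrite gt_eqF.
rewrite ler_pM2l//; nra.
Qed.

Lemma max0_sandwich (a b c : R) : a <= b <= a + c ->
  Num.max 0 (1 + a) <= Num.max 0 (1 + b) <= Num.max 0 (1 + a) + c.
Proof.
by move=> /andP[h1 h2]; rewrite !maxElt; case: (ltP 0 (1 + a)) => ?;
  case: (ltP 0 (1 + b)) => ?; lra.
Qed.

Lemma root_limit (u : R) : 0 <= u <= 1 ->
  (fun n => Num.max 0 (1 - n.+1%:R * (1 - u `^ n.+1%:R^-1))) @ \oo --> Lambda_max u.
Proof.
move=> /andP[u0 u1]; rewrite /Lambda_max leNgt.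
move: u0; rewrite le_eqVlt => /orP[/eqP <-|u0].
  rewrite ltxx /=; under eq_fun.
    move=> n; rewrite powR0 ?invr_eq0 ?pnatr_eq0// subr0 mulr1.
    rewrite max_l; last by rewrite subr_le0 ler1n.
    over.
  exact: cvg_cst.
rewrite u0 /=; set l := ln u.
have l0 : l <= 0 by rewrite ln_le0.
have uE n : u `^ n.+1%:R^-1 = expR (l / n.+1%:R).
  by rewrite /powR gt_eqF// mulrC.
apply: (@squeeze_cvgr _ _ _ _ (fun=> Num.max 0 (1 + l))
  (fun n => Num.max 0 (1 + l) + l ^+ 2 * n.+1%:R^-1)).
- near=> n; rewrite uE; have := ln_root_bounds n l0.
  set A := _ * (expR _ - 1) => hA.
  have -> : 1 - n.+1%:R * (1 - expR (l / n.+1%:R)) = 1 + A by rewrite /A; ring.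
  exact: max0_sandwich.
- exact: cvg_cst.
- have : (fun n => Num.max 0 (1 + l) + l ^+ 2 * n.+1%:R^-1) @ \oo
      --> Num.max 0 (1 + l) + l ^+ 2 * 0.
    by apply: cvgD; [exact: cvg_cst|apply: cvgMl_tmp; exact: cvg_harmonic].
  by rewrite mulr0 addr0.
Unshelve. all: by end_near. Qed.

Lemma cumulativeBounded_01 (F : cumulativeBounded (0 : R) (1 : R)) x :
  0 <= F x <= 1.
Proof.
apply/andP; split; rewrite leNgt; apply/negP => Fx.
- have h : \forall y \near -oo, F x < F y by exact: cvgr_gt (cumulativeNy F) _ Fx.
  have [y [yx Fy]] := filter_ex (filterI (nbhs_ninfty_le (num_real x)) h).
  by have := cumulative_is_nondecreasing F _ _ yx; rewrite leNgt Fy.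
- have h : \forall y \near +oo, F y < F x by exact: cvgr_lt (cumulativey F) _ Fx.
  have [y [yx Fy]] := filter_ex (filterI (nbhs_pinfty_ge (num_real x)) h).
  by have := cumulative_is_nondecreasing F _ _ yx; rewrite leNgt Fy.
Qed.


Lemma Lambda_max_C_I : (fun x : R => Lambda_max (C_I x)) = @F_I R.
Proof.
apply/funext => x; rewrite /Lambda_max /C_I /F_I leNgt expR_gt0 /=.
by rewrite expRK.
Qed.

Lemma Lambda_max_C_II (alpha : R) :
  (fun x => Lambda_max (C_II alpha x)) = F_II alpha.
Proof.
apply/funext => x; rewrite /Lambda_max /C_II /F_II.
case: (0 < x); last by rewrite lexx.
by rewrite leNgt expR_gt0 /= expRK.
Qed.

Lemma Lambda_max_C_III (alpha : R) : 0 < alpha ->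
  (fun x => Lambda_max (C_III alpha x)) = F_III alpha.
Proof.
move=> a0; apply/funext => x; rewrite /Lambda_max /C_III /F_III.
have [x0|x0] := leP x 0; last first.
  rewrite ler10 ln1 addr0 max_r// ifF//; apply/negbTE; rewrite -leNgt; lra.
rewrite leNgt expR_gt0 /= expRK (ler0_norm x0).
have p1 : 1 `^ alpha = 1 :> R by rewrite powR1.
have [x1|x1] := ltP x (-1).
  rewrite max_l// subr_le0 -[leLHS]p1.
  by apply: ge0_ler_powR; rewrite ?nnegrE; lra.
rewrite max_r// subr_ge0 -[leRHS]p1.
by apply: ge0_ler_powR; rewrite ?nnegrE; lra.
Qed.

End Limits.
(** * Maxima of free uniform operators *)

Section Maxima.
Context (R : realType) (H : completeNormedModType R[i]).
Context (ip : {dot H for Num.conj}) (M : set (H -> H)) (tau : (H -> H) -> R[i]).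
Context (U Ut : nat -> H -> H).
Hypotheses (hH : hilbert_norm ip)
    (hM : tracial_Wstar_probability_space ip M tau)
    (MU : forall n, M (U n)) (sU : forall n, selfadjoint ip (U n))
    (hfree : freely_independent tau U)
    (hunif : forall n (B : set R), measurable B ->
       (spectral_distribution ip tau (U n) B)%:E = uniform_prob (@ltr01 R) B)
    (hUt0 : Ut 0%N = U 0%N)
    (hUtS : forall n, spectral_max ip M (Ut n) (U n.+1) (Ut n.+1)).

Local Notation rtau := (rtau tau).
Local Notation E n := (spectral_measure ip (U n)).
Local Notation Et n := (spectral_measure ip (Ut n)).
Let hvn := trace_vn hM.

Lemma spectral_measureP X :
  is_spectral_measure ip X (spectral_measure ip X) \/
  spectral_measure ip X = (fun _ _ => 0).
Proof.
have [[F hF]|h] := pselect (exists F, is_spectral_measure ip X F).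
  by left; exact: (xgetPex _ (ex_intro _ F hF)).
by right; rewrite /spectral_measure xgetPN// => F hF; apply: h; exists F.
Qed.

Lemma E_spec n : is_spectral_measure ip (U n) (E n).
Proof.
have [//|h] := spectral_measureP (U n).
have := hunif n measurableT; rewrite /spectral_distribution h.
rewrite -[complex.Re _]/(rtau _) (rtau0 hM) probability_setT => -[].
by move/eqP; rewrite eq_sym oner_eq0.
Qed.

Lemma rtau_E n (a : R) : rtau (E n `]a, +oo[%classic) = uniform_tail a.
Proof.
apply: EFin_inj; rewrite -uniform_prob_gt -(hunif n)//.
Qed.

Lemma uniform_no_atom (t : R) n (e : R) : 0 < e -> exists2 d : R, 0 < d &
  rtau (E n `]t - d, +oo[%classic) - rtau (E n `]t + d, +oo[%classic) <= e.
Proof.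
move=> e0; have [d d0 hd] := uniform_tail_cont t e0.
by exists d => //; rewrite !rtau_E.
Qed.

Let ME n a : M (E n `]a, +oo[%classic) := M_spec_gt hH hM MU sU E_spec n a.
Let hPE n a : orth_proj ip (E n `]a, +oo[%classic) := spec_gt_proj E_spec n a.

(** A maximum without spectral measure would have zero spectral projections,
    whereas these dominate the ones of the last variable. *)
Lemma Et_props n :
  is_spectral_measure ip (Ut n) (Et n) /\
  forall a : R, [/\ M (Et n `]a, +oo[%classic),
    rtau (Et n `]a, +oo[%classic) <= n.+1%:R * uniform_tail a &
    forall i x, (i <= n)%N ->
      Et n `]a, +oo[%classic (E i `]a, +oo[%classic x) = E i `]a, +oo[%classic x].
Proof.
elim: n => [|n [hEt IH]].
  rewrite hUt0; split; first exact: E_spec.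
  move=> a; split; [exact: ME|by rewrite mul1r rtau_E|].
  by move=> i x; rewrite leqn0 => /eqP ->; exact: proj_idem (hPE 0 a) x.
have [_ _ hmax] := hUtS n.
have hPt a : orth_proj ip (Et n `]a, +oo[%classic).
  by apply: (spec_proj hEt); exact: measurable_itv.
have hEtS : is_spectral_measure ip (Ut n.+1) (Et n.+1).
  have [//|h] := spectral_measureP (Ut n.+1).
  have hj := hmax (-1).
  have E0 : E n.+1 `]-1, +oo[%classic = fun=> 0.
    apply/funext => x; rewrite -(join_fixr (hPt _) hj) h.
    by [].
  have := rtau_E n.+1 (-1); rewrite E0 (rtau0 hM) /uniform_tail.
  by rewrite ltrN10 => /eqP; rewrite eq_sym oner_eq0.
split=> // a; have [MEt tEt domEt] := IH a; have hj := hmax a.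
split.
- exact: (vn_join hH hvn (hPt a) (hPE n.+1 a) hj MEt (ME _ _)).
- have := rtau_join_le hH hM (hPt a) (hPE n.+1 a) hj MEt (ME _ _).
  by rewrite rtau_E -(natr1 n.+1); lra.
- move=> i x; rewrite leq_eqVlt => /orP[/eqP ->|].
    exact: (join_fixr (hPt a) hj).
  by rewrite ltnS => /domEt <-; exact: (join_fixl (hPE n.+1 a) hj).
Qed.

Let hEt n := proj1 (Et_props n).
Let hSt n a : orth_proj ip (Et n `]a, +oo[%classic) := spec_gt_proj hEt n a.

(** Below [0] the first operator has no spectrum, hence the larger ones neither. *)
Lemma Et_neg n x : Et n `]-oo, 0[%classic x = 0.
Proof.
pose F k : set R := `]-oo, - k.+1%:R^-1]%classic.
have -> : `]-oo, 0[%classic = \bigcup_k F k.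
  apply/seteqP; split=> y; rewrite /F /= in_itv /=.
    move=> y0; have ny0 : 0 < - y by rewrite oppr_gt0.
    have [k _ /(_ k (leqnn k)) /= hk] := near_infty_natSinv_lt (PosNum ny0).
    by exists k => //=; rewrite in_itv /= lerNr ltW.
  by move=> [k _]; rewrite /= in_itv /= => /le_lt_trans; apply; rewrite oppr_lt0.
apply: (spec_countable_null (hEt n)) => [k|k]; first exact: measurable_itv.
have b0 : - k.+1%:R^-1 < 0 :> R by rewrite oppr_lt0.
rewrite /F; move: (- k.+1%:R^-1) b0 => b b0.
have E1 y : E 0%N `]b, +oo[%classic y = y.
  have : compl (E 0%N `]b, +oo[%classic) = fun=> 0.
    rewrite -(spec_le_compl E_spec); apply: (rtau_proj0 hM).
    - exact: (M_spec_le hH hM MU sU E_spec).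
    - exact: (spec_le_proj E_spec).
    - by rewrite (spec_le_compl E_spec) (rtau_compl hM)// rtau_E /uniform_tail b0 subrr.
  by move=> /(f_equal (@^~ y)) /subr0_eq.
rewrite (spec_le_gt (hEt n)); have [_ _ dom] := proj2 (Et_props n) b.
by have := dom 0%N x isT; rewrite E1 => ->; rewrite subrr.
Qed.

Lemma Et_itv n (t : R) : 0 <= t ->
  Et n `[0, t]%classic = compl (Et n `]t, +oo[%classic).
Proof.
move=> t0; rewrite -(spec_le_compl hEt); apply/funext => x.
have m0 : measurable (`]-oo, 0[%classic : set R) by exact: measurable_itv.
have mt : measurable (`]-oo, t]%classic : set R) by exact: measurable_itv.
rewrite -[in RHS](subr0 x) -(Et_neg n x) -(specC (hEt n))//.
rewrite (specI (hEt n))//; last exact: measurableC.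
rewrite setCitvl; congr (Et n _ x); apply/seteqP.
by split=> y; rewrite /= !in_itv /= ?andbT; [move=> /andP[-> ->]|move=> [-> ->]].
Qed.

Local Notation P t i := (E i `]-oo, t]%classic).

Lemma tau_P (t : R) i : 0 <= t <= 1 -> tau (P t i) = t%:C.
Proof.
move=> /andP[t0 t1].
have [-> _] := tau_proj hM (M_spec_le hH hM MU sU E_spec i t) (spec_le_proj E_spec i t).
rewrite (spec_le_compl E_spec) (rtau_compl hM)// rtau_E /uniform_tail.
by rewrite ltNge t0 t1 /=; congr (_%:C); ring.
Qed.

Lemma centered_sqr (t : R) i x : 0 <= t <= 1 ->
  centered tau (fun i => E i) t i (centered tau (fun i => E i) t i x)
  = (1 - 2 * t)%:C *: centered tau (fun i => E i) t i x + (t * (1 - t))%:C *: x.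
Proof.
move=> t01; rewrite /centered tau_P//.
have hP := spec_le_proj E_spec i t; have lP := proj_linear hP.
rewrite (linB lP) (linZ _ _ lP) (proj_idem hP); set y := P t i x.
rewrite -[y - _ *: y](_ : (1 - t%:C) *: y = _); last by rewrite scalerBl scale1r.
rewrite !scalerBr !scalerA opprB [LHS]addrCA -scalerBl [LHS]addrC -[RHS]addrA.
congr (_ + _); last rewrite [RHS]addrC -scalerBl; congr (_ *: _);
  by rewrite !(rmorphB, rmorphM, rmorph1) /=; ring.
Qed.

(** The two bounds meet: subadditivity bounds the trace of the join of the [n + 1]
    projections [1 - P i] from above, freeness bounds it from below. *)
Lemma distribution_max n (t : R) : 0 <= t <= 1 ->
  spectral_distribution ip tau (Ut n) `[0, t]%classic
  = Num.max 0 (1 - n.+1%:R * (1 - t)).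
Proof.
move=> /andP[t0 t1]; rewrite /spectral_distribution Et_itv//.
rewrite -[complex.Re _]/(rtau _); set S := Et n _; set e := compl S.
have [MS tS dom] := proj2 (Et_props n) t; rewrite -/S in MS tS dom.
have hS : orth_proj ip S := hSt n t.
have eE : e = Et n `]-oo, t]%classic by rewrite (spec_le_compl hEt).
have he : orth_proj ip e by rewrite eE; exact: spec_le_proj hEt _ _.
have Me : M e by exact: (vn_compl hvn).
have lS := proj_linear hS; have le := proj_linear he.
have [_ te0] := tau_proj hM Me he.
have eP i x : (i <= n)%N -> e (P t i x) = e x.
  move=> im; have -> : P t i x = x - E i `]t, +oo[%classic x.
    by rewrite (spec_le_compl E_spec).
  by rewrite (linB le) [X in _ - X](_ : _ = 0) ?subr0// /e /compl dom// subrr.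
apply/eqP; rewrite eq_le; apply/andP; split; last first.
  rewrite ge_max te0 /=; rewrite (rtau_compl hM)//.
  move: tS; rewrite /uniform_tail ltNge t0 t1 /=; lra.
have [t0'|t0'] := eqVneq t 0.
  apply: (@le_trans _ _ (rtau (P t 0%N))).
    have hP := spec_le_proj E_spec 0 t.
    apply: (rtau_le hM) => //; [exact: (M_spec_le hH hM MU sU E_spec)|
      exact: proj_sa he|exact: proj_sa hP|].
    move=> x; rewrite (rip_proj he) (rip_proj hP) -(eP 0%N)//.
    exact: nsq_proj_le.
  rewrite -[rtau _]/(complex.Re (tau _)) tau_P ?t0 ?t1//= t0'.
  by rewrite le_max lexx.
have t01 : 0 <= t <= 1 by rewrite t0.
have t_gt0 : 0 < t by rewrite lt_def t0'.
apply: (rtau_inf_le hM (p := centered tau (fun i => E i) t)) => //.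
- exact: (M_centered hH hM MU sU E_spec).
- exact: (sa_centered hH hM MU sU E_spec).
- by move=> i x; exact: centered_sqr.
- move=> w; apply: (free_centered hH hM MU sU E_spec hfree).
  exact: uniform_no_atom.
- move=> i x im; rewrite /centered tau_P// (linB le) (linZ _ _ le) eP//.
  by rewrite rmorphB rmorph1 scalerBl scale1r.
Qed.

End Maxima.

Theorem proposition5p1 (R : realType) (H : completeNormedModType R[i])
    (ip : {dot H for Num.conj}) (M : set (H -> H)) (tau : (H -> H) -> R[i])
    (U Ut : nat -> H -> H)
    (hH : hilbert_norm ip)
    (hM : tracial_Wstar_probability_space ip M tau)
    (hU : forall n, [/\ M (U n), selfadjoint ip (U n) & positive_op ip (U n)])
    (hfree : freely_independent tau U)
    (hid : forall n (B : set R), measurable B ->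
       spectral_distribution ip tau (U n) B = spectral_distribution ip tau (U 0%N) B)
    (hunif : forall B : set R, measurable B ->
       (spectral_distribution ip tau (U 0%N) B)%:E = uniform_prob (@ltr01 R) B)
    (hUt0 : Ut 0%N = U 0%N)
    (hUtS : forall n, spectral_max ip M (Ut n) (U n.+1) (Ut n.+1)) :
  let G (F : R -> R) (n : nat) (x : R) : R :=
    spectral_distribution ip tau (Ut n) `[0, F x `^ (n.+1%:R^-1)] in
  (forall F : cumulativeBounded (0 : R) (1 : R),
     weak_cvg (G F) (fun x => Lambda_max (F x))) /\
  (forall alpha : R, 0 < alpha ->
     [/\ weak_cvg (G (@C_I R)) (@F_I R),
         weak_cvg (G (C_II alpha)) (F_II alpha) &
         weak_cvg (G (C_III alpha)) (F_III alpha)]).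
Proof.
move=> G.
have MU n : M (U n) by case: (hU n).
have sU n : selfadjoint ip (U n) by case: (hU n).
have unif n (B : set R) : measurable B ->
    (spectral_distribution ip tau (U n) B)%:E = uniform_prob (@ltr01 R) B.
  by move=> mB; rewrite hid// hunif.
have cvgG F x : 0 <= F x <= 1 -> G F n x @[n --> \oo] --> Lambda_max (F x).
  move=> Fx; have -> : (fun n => G F n x)
      = fun n => Num.max 0 (1 - n.+1%:R * (1 - F x `^ n.+1%:R^-1)).
    apply/funext => n; rewrite /G.
    rewrite (distribution_max hH hM MU sU hfree unif hUt0 hUtS)//.
    have /andP[F0 F1] := Fx; rewrite powR_ge0 /=.
    have p1 : 1 `^ n.+1%:R^-1 = 1 :> R by rewrite powR1.
    by rewrite -[leRHS]p1; apply: ge0_ler_powR; rewrite ?nnegrE ?invr_ge0.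
  exact: root_limit.
have expR_01 (y : R) : 0 <= y -> 0 <= expR (- y) <= 1.
  by move=> y0; rewrite expR_ge0 /= -expR0 ler_expR oppr_le0.
split=> [F x _|alpha a0]; first exact/cvgG/cumulativeBounded_01.
rewrite -(Lambda_max_C_III a0) -Lambda_max_C_II -Lambda_max_C_I.
split=> x _; apply: cvgG.
- by apply: expR_01; exact: expR_ge0.
- rewrite /C_II; case: ifP => _; last by rewrite lexx ler01.
  by apply: expR_01; exact: powR_ge0.
- rewrite /C_III; case: ifP => _; last by rewrite lexx ler01.
  by apply: expR_01; exact: powR_ge0.
Qed.
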